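(* Let $(\Omega,\Sigma)$ be a measurable space, $X$ a real Banach space and $m:\Sigma\to X$ a countably additive vector measure, not identically zero. Suppose that the integration operator $I_m:L_1(m)\to X$ is weakly compact. Then there exist a reflexive Banach space $Y$, a countably additive vector measure $\tilde m:\Sigma\to Y$ and an injective operator $J:Y\to X$ such that $m=J\circ\tilde m$ and $L_1(m)=L_1(\tilde m)$ with equal norms (i.e., the two spaces consist of the same functions and $\|f\|_{L_1(m)}=\|f\|_{L_1(\tilde m)}$ for all $f\in L_1(m)$).
   Context: Operators are continuous linear maps between Banach spaces; $B_Z$ is the closed unit ball of a Banach space $Z$. For a countably additive vector measure $\nu:\Sigma\to Z$ with values in a Banach space $Z$ and $z^*\in Z^*$, $z^*\nu$ is the composition, $|z^*\nu|$ its variation, and $\|\nu\|(A):=\sup_{z^*\in B_{Z^*}}|z^*\nu|(A)$ is the semivariation of $\nu$; $A\in\Sigma$ is $\nu$-null if $\|\nu\|(A)=0$. A $\Sigma$-measurable $f:\Omega\to\mathbb{R}$ is $\nu$-integrable if $\int_\Omega|f|\,d|z^*\nu|<\infty$ for all $z^*\in Z^*$ and for each $A\in\Sigma$ there is $\int_A f\,d\nu\in Z$ with $z^*(\int_A f\,d\nu)=\int_A f\,d(z^*\nu)$ for all $z^*\in Z^*$. $L_1(\nu)$ is the Banach space of $\nu$-integrable functions (identified when equal $\nu$-a.e.) with norm $\|f\|_{L_1(\nu)}=\sup_{z^*\in B_{Z^*}}\int_\Omega|f|\,d|z^*\nu|$. The integration operator is $I_\nu:L_1(\nu)\to Z$,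 $I_\nu(f)=\int_\Omega f\,d\nu$. *)

(* Defs.v *)
From HB Require Import structures.
From mathcomp Require Import all_boot all_order all_algebra.
From mathcomp Require Import all_classical all_reals all_analysis.

Set Implicit Arguments.
Unset Strict Implicit.
Unset Printing Implicit Defensive.

Import Order.TTheory GRing.Theory Num.Theory.
Import numFieldNormedType.Exports.

Local Open Scope classical_set_scope.
Local Open Scope ring_scope.

(* The dual Z^* as a normed module, with the operator norm
   |f| = sup { |f z| : |z| <= 1 }. *)
Section dual.
Context (R : realType) (Z : normedModType R).

Definition continuous_functional : {pred Z -> R^o} :=
  mem [set f : Z -> R^o | linear f /\ continuous f].

Lemma continuous_functional_submod : submod_closed continuous_functional.
Proof.
split; first by rewrite inE; split; [move=> a u v /=; rewrite scaler0 addr0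
                                    |move=> x; exact: cvg_cst].
move=> a f g; rewrite !inE => -[lf cf] [lg cg]; split; last first.
  by move=> x; apply: cvgD; [apply: cvgZl_tmp; exact: cf|exact: cg].
move=> b u v; rewrite !fctE lf lg !scalerDr !scalerA (mulrC a b).
by rewrite addrACA.
Qed.

HB.instance Definition _ := GRing.isSubmodClosed.Build R (Z -> R^o)
  continuous_functional continuous_functional_submod.

Record dual : Type :=
  Dual { dual_fun :> Z -> R^o; _ : dual_fun \in continuous_functional }.

HB.instance Definition _ := [isSub for dual_fun].
HB.instance Definition _ := [Choice of dual by <:].
HB.instance Definition _ := [SubChoice_isSubLmodule of dual by <:].

Lemma dual_linear (f : dual) : linear f.
Proof. by case: f => f /= /[!inE] -[]. Qed.

Lemma dual_continuous (f : dual) : continuous f.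
Proof. by case: f => f /= /[!inE] -[]. Qed.

HB.instance Definition _ (f : dual) :=
  GRing.isLinear.Build R Z R^o *:%R f (dual_linear f).

Definition dual_norm (f : dual) : R :=
  sup [set `|f z| | z in [set z | `|z| <= 1]].

Let has_sup_dual (f : dual) : has_sup [set `|f z| | z in [set z | `|z| <= 1]].
Proof.
split; first by exists `|f 0|, 0 => //=; rewrite normr0.
have /linear_bounded_continuous/bounded_funP/(_ 1)[M fM] := @dual_continuous f.
by exists M => _ [z /= z1 <-]; exact: fM.
Qed.

Let dual_norm_ub (f : dual) z : `|z| <= 1 -> `|f z| <= dual_norm f.
Proof.
by move=> z1; apply: sup_upper_bound; [exact: has_sup_dual|exists z].
Qed.

Let dual_norm_le (f : dual) r :
  (forall z, `|z| <= 1 -> `|f z| <= r) -> dual_norm f <= r.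
Proof.
move=> fr; apply: ge_sup; first by case: (has_sup_dual f).
by move=> _ [z /= z1 <-]; exact: fr.
Qed.

Let dual_normD (f g : dual) : dual_norm (f + g) <= dual_norm f + dual_norm g.
Proof.
apply: dual_norm_le => z z1; rewrite (le_trans (ler_normD _ _))//.
by rewrite lerD// dual_norm_ub.
Qed.

Let dual_normZ (a : R) (f : dual) : dual_norm (a *: f) = `|a| * dual_norm f.
Proof.
have le b (g : dual) : dual_norm (b *: g) <= `|b| * dual_norm g.
  by apply: dual_norm_le => z z1; rewrite normrM ler_wpM2l// dual_norm_ub.
apply/eqP; rewrite eq_le le/=.
have [->|a0] := eqVneq a 0.
  rewrite normr0 mul0r; apply: le_trans (normr_ge0 _) (@dual_norm_ub _ 0 _).
  by rewrite normr0.
rewrite -ler_pdivlMl ?normr_gt0// -normfV.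
by rewrite -{1}[f]scale1r -(mulVf a0) -scalerA le.
Qed.

Let dual_norm_eq0 (f : dual) : dual_norm f = 0 -> f = 0.
Proof.
move=> f0; apply/val_inj/funext => z /=.
have [->|z0] := eqVneq z 0; first by rewrite linear0.
have := @dual_norm_ub f (`|z|^-1 *: z); rewrite f0 linearZ/= normr_le0.
rewrite normrZ normfV normr_id mulVf ?normr_eq0// => /(_ (lexx _)).
by rewrite scaler_eq0 invr_eq0 normr_eq0 (negbTE z0) => /eqP.
Qed.

HB.instance Definition _ := Lmodule_isNormed.Build R dual
  dual_normD dual_normZ dual_norm_eq0.

End dual.

(* The canonical embedding of Z into Z^** is onto. *)
Definition reflexive_space (R : realType) (Z : normedModType R) : Prop :=
  forall phi : dual (dual Z), exists z : Z, forall f : dual Z, phi f = f z.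

(* Z with the coarsest topology making all elements of Z^* continuous. *)
Definition weak (R : realType) (Z : normedModType R) : topologicalType :=
  sup_topology (fun f : dual Z =>
    Topological.on (initial_topology (f : Z -> R^o))).

Definition relatively_weakly_compact (R : realType) (Z : normedModType R)
  (A : set Z) : Prop := precompact (A : set (weak Z)).

(* Variation and integral with respect to a finite signed measure, by its
   Hahn decomposition; the choice of the latter is irrelevant by
   [Hahn_decomposition_uniq]. *)
Section signed_measure.
Context d (T : measurableType d) (R : realType) (mu : {charge set T -> \bar R}).

Lemma hahn_sets_exist :
  exists PN : set T * set T, hahn_decomposition mu PN.1 PN.2.
Proof. by have [P [N PN]] := Hahn_decomposition mu; exists (P, N). Qed.

Definition hahn_sets : set T * set T := sval (cid hahn_sets_exist).

Definition hahn_setsP : hahn_decomposition mu hahn_sets.1 hahn_sets.2 :=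
  svalP (cid hahn_sets_exist).

Definition charge_total_variation : {measure set T -> \bar R} :=
  charge_variation hahn_setsP.

Definition charge_integral (A : set T) (f : T -> R) : \bar R :=
  (\int[jordan_pos hahn_setsP]_(x in A) (f x)%:E
   - \int[jordan_neg hahn_setsP]_(x in A) (f x)%:E)%E.

End signed_measure.

(* The values outside the sigma-algebra are irrelevant. *)
Record vector_measure d (T : measurableType d) (R : realType)
    (Z : normedModType R) := VectorMeasure {
  vmeasure :> set T -> Z;
  vmeasure0 : vmeasure set0 = 0;
  vmeasure_sigma_additive : forall F : (set T)^nat,
    (forall n, measurable (F n)) -> trivIset [set: nat] F ->
    (fun n => \sum_(0 <= i < n) vmeasure (F i)) @ \oo
      --> vmeasure (\bigcup_n F n)
}.

Section vector_measure.
Context d (T : measurableType d) (R : realType) (Z : normedModType R).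
Variable nu : vector_measure T Z.

Definition scalarization (z : dual Z) : set T -> \bar R :=
  fun A => (z (nu A))%:E.

Section scalarization_charge.
Variable z : dual Z.

Let scalarization0 : scalarization z set0 = 0%E.
Proof. by rewrite /scalarization vmeasure0 linear0. Qed.

Let scalarization_fin A : measurable A -> scalarization z A \is a fin_num.
Proof. by []. Qed.

Let scalarization_sigma_additive : semi_sigma_additive (scalarization z).
Proof.
move=> F mF tF _; rewrite /scalarization.
under eq_fun do rewrite sumEFin -linear_sum.
apply/fine_cvgP; split; first exact: nearW.
apply: (cvg_comp _ _ (vmeasure_sigma_additive mF tF)).
exact: dual_continuous.
Qed.

HB.instance Definition _ := isCharge.Build d T R (scalarization z)
  scalarization0 scalarization_fin scalarization_sigma_additive.

End scalarization_charge.

Local Open Scope ereal_scope.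

Definition semivariation (A : set T) : \bar R :=
  ereal_sup [set charge_total_variation (scalarization z) A |
             z in [set z : dual Z | (`|z| <= 1)%R]].

Definition vnull (A : set T) : Prop := measurable A /\ semivariation A = 0.

Definition vae_eq (f g : T -> R) : Prop := vnull [set x | f x <> g x].

Definition is_vintegral (A : set T) (f : T -> R) (v : Z) : Prop :=
  forall z : dual Z, (z v)%:E = charge_integral (scalarization z) A f.

Definition vintegrable (f : T -> R) : Prop :=
  [/\ measurable_fun [set: T] f,
      forall z : dual Z,
        \int[charge_total_variation (scalarization z)]_x `|f x|%:E < +oo &
      forall A, measurable A -> exists v, is_vintegral A f v].

(* Uniquely determined when it exists, because Z^* separates points. *)
Definition vintegral (A : set T) (f : T -> R) : Z :=
  xget 0%R (is_vintegral A f).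

Definition L1_norm (f : T -> R) : \bar R :=
  ereal_sup [set \int[charge_total_variation (scalarization z)]_x `|f x|%:E |
             z in [set z : dual Z | (`|z| <= 1)%R]].

(* Unit ball of L_1(nu), at the level of representatives. *)
Definition L1_ball : set (T -> R) := [set f | vintegrable f /\ L1_norm f <= 1].

Definition integration_operator (f : T -> R) : Z := vintegral [set: T] f.

Definition weakly_compact_integration : Prop :=
  relatively_weakly_compact (integration_operator @` L1_ball).

End vector_measure.

(* L_1(nu1) = L_1(nu2) with equal norms: the same functions are integrable, the
   same functions are identified, and the norms agree. *)
Definition L1_isometric_eq d (T : measurableType d) (R : realType)
    (Z1 Z2 : normedModType R) (nu1 : vector_measure T Z1)
    (nu2 : vector_measure T Z2) : Prop :=
  [/\ forall f, vintegrable nu1 f <-> vintegrable nu2 f,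
      forall f g, vintegrable nu1 f -> vintegrable nu1 g ->
        (vae_eq nu1 f g <-> vae_eq nu2 f g) &
      forall f, vintegrable nu1 f -> L1_norm nu1 f = L1_norm nu2 f].

(* Main.v *)
(* Isometric Davis-Figiel-Johnson-Pelczynski factorization.  Let [K] be the image
   of the unit ball of L_1(m) under the integration operator; it is convex,
   symmetric, contained in [B_X] and relatively weakly compact.  Let [p_n] be the
   Minkowski functional of [(1 - 4^-(n+1)) K + 4^-(n+1) B_X] and
     [Y = {x | sum_n 2^-(n+1) p_n(x)^2 < oo}].
   As the weights sum to [1] and [|x| <= p_n x], with [p_n <= 1] on [K], one has
   [K <= B_Y <= B_X], so both [J : Y -> X] and the lift of the integration operator
   to [Y] are contractions: this is what makes the L_1-norms equal.

   The l^2-type norm makes the functionals [g o J] ([g] in [X^*]) norm dense in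
   [Y^*].  Density gives reflexivity: for [phi] in [Y^**], the functional
   [g |-> phi (g o J)] on [X^*] is within [O(2^-n)] of a point of [X], by
   Hahn-Banach and weak compactness of [K], hence is evaluation at some [x], and
   [phi] is evaluation at [x].  Density also transfers the identity defining
   [int_A f dm] from the functionals [g o J] to all of [Y^*].  The lift of [m] is
   countably additive in [Y] because its norm is dominated by the semivariation of
   [m], which tends to [0] along the tails of a disjoint sequence. *)
From HB Require Import structures.
Require Import Defs.
From mathcomp Require Import all_boot all_order all_algebra.
From mathcomp Require Import all_classical all_reals all_analysis.
From mathcomp Require Import measurable_realfun ring lra.

Set Implicit Arguments.
Unset Strict Implicit.
Unset Printing Implicit Defensive.

Import Order.TTheory GRing.Theory Num.Theory.
Import numFieldNormedType.Exports.

Local Open Scope classical_set_scope.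
Local Open Scope ring_scope.

(** * The Hahn-Banach theorem *)

Section sublinear.
Context {R : realType} {V : lmodType R}.
Implicit Types (p q k : V -> R) (C : set V).

(** The gauges are defined on the dual side, as suprema over polars, so that [K] enters only through
    its support function. The constants balance two demands: testing a functional of [Y] through the
    [n]-th gauge costs at most the inverse weight [2^(n+1)], while the ball contributes [4^-(n+1)];
    the product [2^-(n+1)] tends to [0].

    The obstacle to equality of the norms is that [Y^*] may contain functionals [h] not of the form
    [g o J], for which nothing is known a priori about integrals against [h o mt]. Density transfers
    an identity only if both sides are bounded linearly in [|h|], and for the integral that bound is
    essentially the norm inequality to be proved. The circle is broken with bounded functions, where
    a crude bound comes from the finite semivariation of [m]. The lifted integral is then available
    and yields the bound with constant one; monotone convergence along truncations extends it to all
    integrable functions, to which density then applies as well. *)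

Definition sublinear_on C p :=
  (forall u v, C u -> C v -> p (u + v) <= p u + p v) /\
  (forall a u, 0 <= a -> C u -> p (a *: u) = a * p u).

Definition convex_cone C :=
  [/\ C 0, forall u v, C u -> C v -> C (u + v) &
      forall a u, 0 <= a -> C u -> C (a *: u)].

(** The infimal convolution of [p] with the reflection of [k], where [k] counts as infinite off [C].
    A linear [f] below it is below [p] and satisfies [- f u <= k u] on [C]. *)
Definition infconv p C k (v : V) : R := inf [set p (v + u) + k u | u in C].

Lemma convex_coneT : convex_cone setT.
Proof. by []. Qed.

Lemma sublinear_on0 C p : C 0 -> sublinear_on C p -> p 0 = 0.
Proof. by move=> C0 [_ /(_ 0 0 (lexx _) C0)]; rewrite scale0r mul0r. Qed.

Lemma sublinear_ge p v : sublinear_on setT p -> - p (- v) <= p v.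
Proof.
move=> sp; rewrite lerNl -subr_ge0 opprK addrC.
rewrite -(sublinear_on0 I sp) -{1}(subrr v).
by case: sp => + _; exact.
Qed.

Section infconv.
Variables (p : V -> R) (C : set V) (k : V -> R).
Hypotheses (sp : sublinear_on setT p) (cC : convex_cone C)
  (sk : sublinear_on C k) (pk : forall u, C u -> 0 <= p u + k u).

Let pD u v : p (u + v) <= p u + p v.
Proof. by case: sp => + _; exact. Qed.

Let C0 : C 0. Proof. by case: cC. Qed.

(** Subadditivity gives [p u <= p (v + u) + p (- v)], so [pk] keeps the infimum finite. *)
Let infconv_lb v : lbound [set p (v + u) + k u | u in C] (- p (- v)).
Proof.
move=> _ [u Cu <-]; have := pk Cu; have := pD (v + u) (- v).
rewrite addrAC subrr add0r; lra.
Qed.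

Lemma infconv_le v u : C u -> infconv p C k v <= p (v + u) + k u.
Proof. by move=> Cu; apply: ge_inf; [exists (- p (- v))|exists u]. Qed.

Lemma infconv_ge v x : (forall u, C u -> x <= p (v + u) + k u) ->
  x <= infconv p C k v.
Proof.
move=> xv; apply: lb_le_inf; first by exists (p (v + 0) + k 0), 0.
by move=> _ [u Cu <-]; exact: xv.
Qed.

Lemma infconv_le_l v : infconv p C k v <= p v.
Proof.
by apply: le_trans (infconv_le v C0) _; rewrite addr0 (sublinear_on0 C0 sk) addr0.
Qed.

Lemma infconv_le_r u : C u -> infconv p C k (- u) <= k u.
Proof.
by move=> Cu; apply: le_trans (infconv_le _ Cu) _;
  rewrite addNr (sublinear_on0 I sp) add0r.
Qed.

Lemma sublinear_infconv : sublinear_on setT (infconv p C k).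
Proof.
have hle a v : 0 < a -> infconv p C k (a *: v) <= a * infconv p C k v.
  move=> a0; rewrite -ler_pdivrMl//; apply: infconv_ge => u Cu.
  rewrite ler_pdivrMl//; have [_ _ CZ] := cC.
  apply: le_trans (infconv_le _ (CZ _ _ (ltW a0) Cu)) _.
  by rewrite -scalerDr (sp.2 _ _ (ltW a0) I) (sk.2 _ _ (ltW a0) Cu) mulrDr.
split=> [v w _ _|a v a0 _].
  rewrite -lerBlDr; apply: infconv_ge => u Cu.
  rewrite lerBlDr -lerBlDl; apply: infconv_ge => t Ct; rewrite lerBlDl.
  have [_ CD _] := cC; apply: le_trans (infconv_le _ (CD _ _ Cu Ct)) _.
  have := sk.1 _ _ Cu Ct; have := pD (v + u) (w + t).
  rewrite addrACA; lra.
move: a0; rewrite le_eqVlt => /predU1P[<-|a0].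
  rewrite scale0r mul0r; apply/eqP; rewrite eq_le; apply/andP; split.
    by rewrite (le_trans (infconv_le_l 0))// (sublinear_on0 I sp).
  by apply: infconv_ge => u Cu; rewrite add0r pk.
apply/eqP; rewrite eq_le hle//= -ler_pdivlMl//.
by apply: le_trans (hle _ _ _); rewrite ?invr_gt0// scalerA mulVf ?scale1r ?gt_eqF.
Qed.

End infconv.

(* Passing to the infimal convolution with [- q] on a ray shows that a minimal
   sublinear functional is odd, hence linear. *)
Lemma minimal_sublinear q : sublinear_on setT q ->
  (forall r, sublinear_on setT r -> (forall v, r v <= q v) -> r = q) ->
  exists f : {linear V -> R^o}, f = q :> (V -> R).
Proof.
move=> sq qmin.
have qN x : q (- x) = - q x.
  apply/eqP; rewrite eq_le; apply/andP; split; last first.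
    by rewrite lerNl; exact: sublinear_ge.
  pose C := [set u | exists2 t : R, 0 <= t & u = t *: x].
  have cC : convex_cone C.
    split; first by exists 0; rewrite ?scale0r.
      by move=> _ _ [t t0 ->] [u u0 ->]; exists (t + u); rewrite ?addr_ge0 ?scalerDl.
    by move=> a _ a0 [t t0 ->]; exists (a * t); rewrite ?mulr_ge0 ?scalerA.
  have sk : sublinear_on C (fun u => - q u).
    split=> [_ _ [t t0 ->] [u u0 ->]|a u a0 _]; last by rewrite sq.2// mulrN.
    by rewrite -scalerDl !sq.2// ?addr_ge0// mulrDl opprD.
  have kq u : C u -> 0 <= q u + (- q u) by rewrite subrr.
  have -> : q (- x) = infconv q C (fun u => - q u) (- x).
    rewrite (qmin (infconv q C (fun u => - q u)))//.
      exact: (sublinear_infconv sq cC sk kq).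
    exact: (infconv_le_l sq cC sk kq).
  by apply: (infconv_le_r sq kq); exists 1; rewrite ?scale1r.
have qD x y : q (x + y) = q x + q y.
  apply/eqP; rewrite eq_le sq.1//=.
  have := sq.1 (x + y) (- y) I I; rewrite addrK qN; lra.
suff lq : linear (q : V -> R^o).
  pose f : {linear V -> R^o} := HB.pack (q : V -> R^o)
    (GRing.isLinear.Build R V R^o *:%R q lq).
  by exists f.
move=> a x y; rewrite qD; congr (_ + _).
have [a0|a0] := leP 0 a; first by rewrite sq.2.
rewrite -[a]opprK scaleNr qN sq.2 ?oppr_ge0 ?ltW//.
by rewrite [_ *: _]scaleNr.
Qed.

(** Zorn's lemma for the reversed pointwise order. The infimum of a chain is finite because every
    sublinear [q <= p] satisfies [- p (- v) <= q v], and subadditive because of two members of a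
    chain one lies below both. *)
Lemma sublinear_dominates_linear p : sublinear_on setT p ->
  exists f : {linear V -> R^o}, forall v, f v <= p v.
Proof.
move=> sp; pose S := {q : V -> R | sublinear_on setT q /\ forall v, q v <= p v}.
pose Q (q r : S) := `[< forall v, sval r v <= sval q v >].
have [| | | |[q [sq qp]] qmin] := @Zorn S Q.
- by move=> t; exact/asboolP.
- move=> r s t /asboolP rs /asboolP st; apply/asboolP => v.
  exact: le_trans (st v) (rs v).
- move=> [s hs] [t ht] /asboolP/= st /asboolP/= ts; apply: eq_exist.
  by apply/funext => v; apply/eqP; rewrite eq_le st ts.
- move=> A tA; have [->|/set0P[s0 As0]] := eqVneq A set0.
    by exists (exist _ p (conj sp (fun=> lexx _))).
  have lbA v : lbound [set sval q v | q in A] (- p (- v)).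
    move=> _ [[q [sq qp]] Aq <-] /=.
    by apply: le_trans (sublinear_ge v sq); rewrite lerN2.
  pose i v := inf [set sval q v | q in A].
  have ile (q : S) v : A q -> i v <= sval q v.
    by move=> Aq; apply: ge_inf; [exists (- p (- v))|exists q].
  have ige v x : (forall q : S, A q -> x <= sval q v) -> x <= i v.
    move=> h; apply: lb_le_inf; first by exists (sval s0 v), s0.
    by move=> _ [q Aq <-]; exact: h.
  have si : sublinear_on setT i.
    split=> [u v _ _|a v a0 _].
      rewrite -lerBlDr; apply: (ige _ _) => q Aq.
      rewrite lerBlDr -lerBlDl; apply: (ige _ _) => r Ar; rewrite lerBlDl.
      have [t [At tq tr]] : exists t, [/\ A t, forall v, sval t v <= sval q v &
          forall v, sval t v <= sval r v].
        by have [/asboolP|/asboolP] := tA _ _ Aq Ar; [exists r|exists q].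
      apply: le_trans (ile t _ At) _.
      have [[st _] _] := svalP t; apply: le_trans (st _ _ I I) _.
      by rewrite lerD.
    have hZ (q : S) b w : 0 <= b -> sval q (b *: w) = b * sval q w.
      by move=> b0; have [[_ sZ] _] := svalP q; rewrite sZ.
    move: a0; rewrite le_eqVlt => /predU1P[<-|a0].
      rewrite scale0r mul0r; apply/eqP; rewrite eq_le; apply/andP; split.
        by apply: le_trans (ile _ _ As0) _; rewrite -(scale0r 0) hZ// mul0r.
      by apply: (ige _ _) => q _; rewrite -(scale0r 0) hZ// mul0r.
    apply/eqP; rewrite eq_le; apply/andP; split.
      rewrite -ler_pdivrMl//; apply: (ige _ _) => q Aq; rewrite ler_pdivrMl//.
      by have := ile q (a *: v) Aq; rewrite (hZ q _ _ (ltW a0)).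
    apply: (ige _ _) => q Aq; rewrite (hZ q _ _ (ltW a0)) ler_pM2l//.
    exact: (ile q v Aq).
  have ip v : i v <= p v.
    by apply: le_trans (ile _ _ As0) _; have [_] := svalP s0.
  by exists (exist _ i (conj si ip)) => s As; apply/asboolP => v; exact: (ile s v As).
- have [|f fq] := minimal_sublinear sq; last by exists f => v; rewrite fq.
  move=> r sr rq.
  have rp v : r v <= p v := le_trans (rq v) (qp v).
  have /(_ _)/(congr1 sval)/= := qmin (exist _ r (conj sr rp)).
  by apply; exact/asboolP.
Qed.

(** One form for three uses: [C] is the whole space in [linear_sub_sum], a ray in [linear_norming],
    and the range of [J] in [interp_dual_dense]. *)
Lemma hahn_banach p C k : sublinear_on setT p -> convex_cone C ->
  sublinear_on C k -> (forall u, C u -> 0 <= p u + k u) ->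
  exists f : {linear V -> R^o},
    (forall v, f v <= p v) /\ (forall u, C u -> - f u <= k u).
Proof.
move=> sp cC sk pk.
have [f fr] := sublinear_dominates_linear (sublinear_infconv sp cC sk pk).
exists f; split=> [v|u Cu]; rewrite -?linearN; apply: le_trans (fr _) _.
  exact: (infconv_le_l sp).
exact: (infconv_le_r sp).
Qed.

Lemma linear_sub_sum (f : {linear V -> R^o}) p q :
  sublinear_on setT p -> sublinear_on setT q ->
  (forall v, f v <= p v + q v) ->
  exists f1 : {linear V -> R^o},
    (forall v, f1 v <= p v) /\ (forall v, f v - f1 v <= q v).
Proof.
move=> sp sq fpq.
have [| |f1 [f1p f1q]] := @hahn_banach p setT (fun v => q v - f v) sp
  convex_coneT; [split| | ].
- by move=> u v _ _; rewrite linearD; have := sq.1 u v I I; lra.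
- by move=> a v a0 _; rewrite linearZ_LR/= sq.2// mulrBr.
- by move=> v _; have := fpq v; lra.
- by exists f1; split=> // v; have := f1q v I; lra.
Qed.

(** On the ray through [x] the functional [p] is additive, so [- p] is an admissible [k] there and
    forces [f x >= p x]. *)
Lemma linear_norming p (x : V) : sublinear_on setT p ->
  exists f : {linear V -> R^o}, (forall v, f v <= p v) /\ f x = p x.
Proof.
move=> sp; pose C := [set u | exists2 t : R, 0 <= t & u = t *: x].
have [| | |f [fp fC]] := @hahn_banach p C (fun u => - p u) sp.
- split; first by exists 0; rewrite ?scale0r.
    by move=> _ _ [t t0 ->] [u u0 ->]; exists (t + u); rewrite ?addr_ge0 ?scalerDl.
  by move=> a _ a0 [t t0 ->]; exists (a * t); rewrite ?mulr_ge0 ?scalerA.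
- split=> [_ _ [t t0 ->] [u u0 ->]|a u a0 _]; last by rewrite sp.2// mulrN.
  by rewrite -scalerDl !sp.2// ?addr_ge0// mulrDl opprD.
- by move=> u _; rewrite subrr.
- exists f; split=> //; apply/eqP; rewrite eq_le fp/=.
  have /fC : C x by exists 1; rewrite ?scale1r.
  by rewrite lerN2.
Qed.

End sublinear.

(** * Dual spaces *)

Lemma cvg_dist_le (R : realType) (V : normedModType R) (T : Type)
    (F : set_system T) {PF : ProperFilter F} (f : T -> V) (l y : V) (c : R) :
  f @ F --> l -> (\near F, `|y - f F| <= c) -> `|y - l| <= c.
Proof.
move=> fl yc.
exact: (closed_cvg (closed_ball_ Num.norm y c)
  (@closed_closed_ball_ R V y c) yc l fl).
Qed.

Section dual_theory.
Context {R : realType} {Z : normedModType R}.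
Implicit Types (f g : dual Z) (z : Z).

Lemma dual_normE f : `|f| = sup [set `|f z| | z in [set z | `|z| <= 1]].
Proof. by []. Qed.

Lemma dualD f g z : (f + g) z = f z + g z.
Proof. by []. Qed.

Lemma dualN f z : (- f) z = - f z.
Proof. by []. Qed.

Lemma dualZ a f z : (a *: f) z = a * f z.
Proof. by []. Qed.

Lemma dual_addr f x y : f (x + y) = f x + f y.
Proof. exact: linearD. Qed.

Lemma dual_oppr f x : f (- x) = - f x.
Proof. exact: linearN. Qed.

Lemma dual_subr f x y : f (x - y) = f x - f y.
Proof. exact: linearB. Qed.

Lemma dual_scaler f a x : f (a *: x) = a * f x.
Proof. exact: linearZ. Qed.

Lemma dual_sum I (r : seq I) (F : I -> dual Z) z :
  (\sum_(i <- r) F i) z = \sum_(i <- r) F i z.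
Proof. by elim/big_ind2 : _ => // _ x _ y <- <-. Qed.

Lemma dual_norm_le f r : (forall z, `|z| <= 1 -> `|f z| <= r) -> `|f| <= r.
Proof.
move=> fr; rewrite dual_normE; apply: ge_sup; first by exists `|f 0|, 0 => //=; rewrite normr0.
by move=> _ [z /= z1 <-]; exact: fr.
Qed.

Lemma dual_norm_ub f z : `|z| <= 1 -> `|f z| <= `|f|.
Proof.
move=> z1; rewrite dual_normE; apply: sup_upper_bound; last by exists z.
split; first by exists `|f 0|, 0 => //=; rewrite normr0.
have /linear_bounded_continuous/bounded_funP/(_ 1)[M fM] := @dual_continuous _ _ f.
by exists M => _ [y /= y1 <-]; exact: fM.
Qed.

Lemma dual_ler_norm f z : `|f z| <= `|f| * `|z|.
Proof.
have [->|z0] := eqVneq z 0; first by rewrite linear0 !normr0 mulr0.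
have := @dual_norm_ub f (`|z|^-1 *: z); rewrite linearZ/=.
rewrite normrZ normfV normr_id mulVf ?normr_eq0// => /(_ (lexx _)).
by rewrite normrM normfV normr_id ler_pdivrMl ?normr_gt0// mulrC.
Qed.

Lemma dual_le f z : f z <= `|f| * `|z|.
Proof. exact: le_trans (ler_norm _) (dual_ler_norm _ _). Qed.

Lemma dual_norm_ler f r : 0 <= r -> (forall z, `|f z| <= r * `|z|) -> `|f| <= r.
Proof.
by move=> r0 fr; apply: dual_norm_le => z z1; rewrite (le_trans (fr z))// ler_piMr.
Qed.

Lemma bounded_dual (F : {linear Z -> R^o}) r :
  (forall z, `|F z| <= r * `|z|) -> exists f : dual Z, forall z, f z = F z.
Proof.
move=> Fr; have cF : continuous F.
  apply/linear_bounded_continuous/linear_boundedP.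
  exists r; split=> [|t /ltW rt z]; first exact: num_real.
  by rewrite (le_trans (Fr z))// ler_wpM2r.
have FF : (F : Z -> R^o) \in @continuous_functional R Z.
  by apply: mem_set; split=> //; exact: linearP.
by exists (Dual FF).
Qed.

Lemma le_dual_norming (p : Z -> R) C z : sublinear_on setT p ->
  (forall u, p u <= C * `|u|) ->
  exists f : dual Z, (forall u, f u <= p u) /\ f z = p z.
Proof.
move=> sp pC; have [F [Fp Fz]] := linear_norming z sp.
have [|f fF] := @bounded_dual F C.
  move=> u; rewrite ler_norml (le_trans (Fp u))// andbT lerNl -linearN.
  by rewrite (le_trans (Fp _))// -(normrN u).
by exists f; split => [u|]; rewrite fF.
Qed.

Lemma sublinear_norm c : 0 <= c -> sublinear_on setT (fun z : Z => c * `|z|).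
Proof.
move=> c0; split=> [u v _ _|a u a0 _].
  by rewrite -mulrDr ler_wpM2l// ler_normD.
by rewrite normrZ ger0_norm// mulrCA.
Qed.

Lemma dual_norming z : exists f : dual Z, `|f| <= 1 /\ f z = `|z|.
Proof.
have [f [fp fz]] := le_dual_norming z (sublinear_norm ler01) (fun=> lexx _).
exists f; split; last by rewrite fz mul1r.
apply: dual_norm_le => u u1; rewrite ler_norml lerNl -linearN.
by apply/andP; split; apply: le_trans (fp _) _; rewrite mul1r ?normrN.
Qed.

Lemma dual_norm_point z r : (forall f : dual Z, `|f| <= 1 -> f z <= r) ->
  `|z| <= r.
Proof. by move=> h; have [f [f1 <-]] := dual_norming z; exact: h. Qed.

Lemma dual_separates z1 z2 : (forall f : dual Z, f z1 = f z2) -> z1 = z2.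
Proof.
move=> h; apply/eqP; rewrite -subr_eq0 -normr_eq0 eq_le normr_ge0 andbT.
by apply: dual_norm_point => f _; rewrite linearB/= h subrr.
Qed.

(** Completeness makes the uniform boundedness principle applicable on [dual Z], as in
    [L1_norm_lty]. The limit is taken pointwise, and [lF] passes the Cauchy estimate to it. *)
Lemma dual_complete (F : set_system (dual Z)) :
  ProperFilter F -> cauchy F -> cvg F.
Proof.
move=> PF cF.
have cF' e : 0 < e -> exists f, F [set g | `|f - g| <= e].
  move=> e0; have /cauchyP/(_ _ e0)[f Ff] := cF.
  by exists f; apply: filterS Ff => g; rewrite -ball_normE => /ltW.
have cvgz z : cvg ((fun f : dual Z => f z : R^o) @ F).
  apply: cauchy_cvg; apply: cauchy_exP => e e0.
  have [|f Ff] := cF' (e / (`|z| + 1) / 2); first by rewrite !divr_gt0// ltr_wpDl.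
  exists (f z); rewrite fmapE; apply: (filterS _ Ff) => g /= fg.
  rewrite -ball_normE /ball_/=.
  rewrite (_ : f z - g z = (f - g) z)//.
  rewrite (le_lt_trans (dual_ler_norm _ _))//.
  apply: (@le_lt_trans _ _ (e / (`|z| + 1) / 2 * (`|z| + 1))).
    by rewrite ler_pM// lerDl.
  rewrite mulrAC divfK ?gt_eqF ?ltr_wpDl//; lra.
pose l z := lim ((fun f : dual Z => f z : R^o) @ F).
have ll : linear (l : Z -> R^o).
  move=> a u v; apply: cvg_lim => //.
  under eq_fun do rewrite linearP.
  by apply: cvgD; [apply: cvgZr|]; exact: cvgz.
pose L : {linear Z -> R^o} := HB.pack (l : Z -> R^o)
  (GRing.isLinear.Build R Z R^o *:%R l ll).
have lF e f z : F [set g | `|f - g| <= e] -> `|f z - l z| <= e * `|z|.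
  move=> Ff.
  apply: (cvg_dist_le (cvgz z)); apply: (filterS _ Ff) => g /= fg.
  rewrite (_ : f z - g z = (f - g) z)//.
  by rewrite (le_trans (dual_ler_norm _ _))// ler_wpM2r.
have [f1 Ff1] := cF' 1 ltr01.
have [|f fl] := @bounded_dual L (`|f1| + 1).
  move=> z; rewrite mulrDl -lerBlDl (le_trans _ (lF _ _ z Ff1))//.
  have := dual_ler_norm f1 z; have := ler_distD (f1 z) 0 (l z).
  rewrite !sub0r !normrN => ? ?.
  rewrite lerBlDl (le_trans (y := `|f1 z| + `|f1 z - l z|))// lerD2r//.
apply/cvg_ex; exists f; apply/cvgrPdist_le => e e0.
have [|g Fg] := cF' (e / 2); first by rewrite divr_gt0.
apply: (filterS _ (Fg)) => h /= gh.
have -> : f - h = (f - g) + (g - h) by rewrite addrA subrK.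
rewrite (splitr e) (le_trans (ler_normD _ _))// lerD//.
rewrite distrC; apply: dual_norm_ler; first by rewrite divr_ge0// ltW.
by move=> z; rewrite dualD dualN fl; exact: (lF (e / 2)).
Qed.

HB.instance Definition _ := Uniform_isComplete.Build (dual Z) dual_complete.

End dual_theory.

(** * Weak compactness and representation of functionals on the dual *)

Section weak_compactness.
Context {R : realType} {Z : normedModType R}.
Variables (K : set Z) (psi : {linear dual Z -> R^o}).
Hypotheses (K0 : K !=set0) (K1 : forall k, K k -> `|k| <= 1)
  (convexK : forall k l t, K k -> K l -> 0 <= t <= 1 -> K (k + t *: (l - k)))
  (psiK : forall (f : dual Z) c, (forall k, K k -> f k <= c) -> psi f <= c).

(* Minimise the sum of the [(g k - psi g)^2] over [K] up to [eta] and compare a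
   near minimiser [k] with the points [k + t (l - k)] of [K]. *)
Lemma finite_dual_approx (s : seq (dual Z)) e : 0 < e ->
  exists2 k, K k & \sum_(g <- s) (g k - psi g) ^+ 2 <= e.
Proof.
move=> e0; pose F k : R := \sum_(g <- s) (g k - psi g) ^+ 2.
have F0 k : 0 <= F k by apply: sumr_ge0 => g _; exact: sqr_ge0.
pose M : R := \sum_(g <- s) (2 * `|g|) ^+ 2.
have M0 : 0 <= M by apply: sumr_ge0 => g _; exact: sqr_ge0.
(* The gap [t ^+ 2] allowed to the near minimiser matches the second-order term of a move of length
   [t]. Dividing by [t] leaves an error of at most [t * (1 + M) <= e], where [M] bounds the sum of
   the [(g l - g k) ^+ 2] since [|l - k| <= 2]. *)
pose t : R := Num.min 1 (e / (1 + M)).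
have t0 : 0 < t by rewrite lt_min ltr01 divr_gt0// ltr_pwDl.
have t1 : t <= 1 by rewrite ge_min lexx.
have tM : t * (1 + M) <= e.
  by rewrite -ler_pdivlMr ?ltr_pwDl// ge_min lexx orbT.
have infF : has_inf [set F k | k in K].
  split; first by case: K0 => k Kk; exists (F k), k.
  by exists 0 => _ [k _ <-].
have [_ [k Kk <-] Fk] := inf_adherent (exprn_gt0 2 t0) infF.
exists k => //; change (F k <= e).
(* Half the gradient of [F] at [k]. Since [F k = h k - psi h], a bound on [psi (- h)] obtained from
   [psiK] bounds [F k]. *)
pose h : dual Z := \sum_(g <- s) (g k - psi g) *: g.
have hE x : h x = \sum_(g <- s) (g k - psi g) * g x.
  by rewrite /h dual_sum; apply: eq_bigr => g _; rewrite dualZ.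
have psihE : psi h = \sum_(g <- s) (g k - psi g) * psi g.
  by rewrite /h linear_sum/=; apply: eq_bigr => g _; rewrite linearZ.
have FE : F k = h k - psi h.
  by rewrite hE psihE -sumrB; apply: eq_bigr => g _; rewrite -mulrBr expr2.
suff : psi (- h) <= - h k + t * (1 + M).
  by rewrite linearN/= => ?; rewrite FE; move: tM; lra.
apply: psiK => l Kl; rewrite dualN.
have : F k < F (k + t *: (l - k)) + t ^+ 2.
  apply: lt_le_trans Fk _; rewrite lerD2r; apply: ge_inf; first exact: infF.2.
  by exists (k + t *: (l - k)) => //; apply: convexK; rewrite ?(ltW t0).
have -> : F (k + t *: (l - k)) = F k + 2 * t * (h l - h k) +
    t ^+ 2 * \sum_(g <- s) (g l - g k) ^+ 2.
  rewrite !hE -sumrB !mulr_sumr -!big_split/=; apply: eq_bigr => g _.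
  rewrite linearD linearZ/= linearB/= /GRing.scale/=; ring.
have le_M : \sum_(g <- s) (g l - g k) ^+ 2 <= M.
  apply: ler_sum => g _; rewrite -linearB/= -real_normK ?num_real//.
  rewrite lerXn2r ?nnegrE// ?mulr_ge0// (le_trans (dual_ler_norm _ _))//.
  rewrite mulrC ler_wpM2r// (le_trans (ler_normB _ _))//.
  by have := K1 Kk; have := K1 Kl; lra.
have t2 : 0 < t ^+ 2 by rewrite exprn_gt0.
set S := \sum_(_ <- _) _ in le_M *; set a := h l - h k => hh.
have {}hh : 0 < 2 * a + t * (1 + S).
  rewrite -(pmulr_rgt0 _ t0).
  have -> : t * (2 * a + t * (1 + S)) = 2 * t * a + t ^+ 2 * S + t ^+ 2 by ring.
  by move: hh; lra.
have : t * (1 + S) <= t * (1 + M) by rewrite ler_pM2l// lerD2l.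
have : 0 <= t * (1 + M) by rewrite mulr_ge0 ?(ltW t0)// addr_ge0.
by rewrite /a in hh *; lra.
Qed.

Lemma weak_continuous (f : dual Z) : continuous (f : weak Z -> R^o).
Proof.
move=> x.
have h := (@cvg_sup Z (dual Z) (fun f : dual Z =>
  Topological.on (initial_topology (f : Z -> R^o))) (nbhs (x : weak Z)) x
  (@nbhs_filter (weak Z) x)).1 (fun _ h => h) f.
exact: (cvg_comp _ _ h (@initial_continuous _ _ (f : Z -> R^o) x)).
Qed.

(** [psiK] places [psi] in the weak-star closed convex hull of [K] in the bidual, and
    [finite_dual_approx] makes the sets [B] nonempty. They generate a filter on [K]; a weak cluster
    point of it is the required [x], because each [f] is weakly continuous and close to [psi f]
    along the filter. *)
Lemma weakly_compact_representation : relatively_weakly_compact K ->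
  exists x, forall f, psi f = f x.
Proof.
rewrite /relatively_weakly_compact precompactE => cK.
pose D := [set i : seq (dual Z) * R | 0 < i.2].
pose B (i : seq (dual Z) * R) : set (weak Z) :=
  [set x | K x /\ \sum_(g <- i.1) (g x - psi g) ^+ 2 <= i.2].
pose F := filter_from D B.
have FF : ProperFilter F.
  apply: filter_from_proper => [|i Di]; last first.
    by have [k Kk ke] := finite_dual_approx i.1 Di; exists k.
  apply: filter_from_filter => [|i j Di Dj]; first by exists ([::], 1); exact: ltr01.
  exists (i.1 ++ j.1, Num.min i.2 j.2); first by rewrite /D/= lt_min Di Dj.
  have ge0 (s : seq (dual Z)) x : 0 <= \sum_(g <- s) (g x - psi g) ^+ 2.
    by apply: sumr_ge0 => ? _; exact: sqr_ge0.
  move=> x [Kx]/=; rewrite big_cat/= le_min => /andP[xi xj]; split; split => //.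
    by apply: le_trans xi; rewrite lerDl ge0.
  by apply: le_trans xj; rewrite lerDr ge0.
have [|x [_ Fx]] := cK F FF.
  by exists ([::], 1); [exact: ltr01|move=> x [Kx _]; exact: subset_closure].
exists x => f; apply/eqP; rewrite -subr_eq0 -normr_eq0.
rewrite eq_le normr_ge0 andbT; apply/ler_addgt0Pl => e e0; rewrite addr0.
have e2 : 0 < e / 2 by rewrite divr_gt0.
have /cvgrPdist_le/(_ _ e2) xf := @weak_continuous f x.
have [|y [[_ /=]]] := Fx (B ([:: f], (e / 2) ^+ 2)) _ _ xf.
  by exists ([:: f], (e / 2) ^+ 2) => //; rewrite /D/= exprn_gt0.
rewrite big_seq1 -(@real_normK _ (f y - psi f)) ?num_real//.
move=> h1 h2; have {}h1 : `|f y - psi f| <= e / 2.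
  by rewrite -(@ler_pXn2r _ 2)// nnegrE ltW.
rewrite distrC (_ : f x - psi f = (f x - f y) + (f y - psi f)); last by rewrite addrA subrK.
by rewrite (le_trans (ler_normD _ _))// (splitr e) lerD.
Qed.

End weak_compactness.

(** * Interpolation norms *)

(** Minkowski's inequality in the plane with weights [1] and [w]: the induction step of
    [interp_normD]. *)
Lemma ler_sqrt_sum2 (R : realType) (w a b c d : R) : 0 <= w ->
  (a + c) ^+ 2 + w * (b + d) ^+ 2 <=
  (Num.sqrt (a ^+ 2 + w * b ^+ 2) + Num.sqrt (c ^+ 2 + w * d ^+ 2)) ^+ 2.
Proof.
move=> w0.
have A0 : 0 <= a ^+ 2 + w * b ^+ 2 by rewrite addr_ge0 ?sqr_ge0 ?(mulr_ge0 w0) ?sqr_ge0.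
have B0 : 0 <= c ^+ 2 + w * d ^+ 2 by rewrite addr_ge0 ?sqr_ge0 ?(mulr_ge0 w0) ?sqr_ge0.
rewrite [leRHS]sqrrD !sqr_sqrtr// -sqrtrM//.
suff : a * c + w * (b * d) <= Num.sqrt ((a ^+ 2 + w * b ^+ 2) * (c ^+ 2 + w * d ^+ 2)).
  rewrite -mulr_natl; set S := Num.sqrt _; lra.
apply: le_trans (ler_norm _) _; rewrite -sqrtr_sqr ler_sqrt ?mulr_ge0//.
by have := mulr_ge0 w0 (sqr_ge0 (a * d - b * c)); lra.
Qed.

(* A seminorm on the dual, to be thought of as the support function of an
   absolutely convex subset [K] of the unit ball. *)
Record dual_seminorm (R : realType) (X : normedModType R) := DualSeminorm {
  seminorm_fun :> dual X -> R;
  seminorm_ge0 : forall f, 0 <= seminorm_fun f;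
  seminormD : forall f g,
    seminorm_fun (f + g) <= seminorm_fun f + seminorm_fun g;
  seminormZ : forall a f, seminorm_fun (a *: f) = `|a| * seminorm_fun f;
  seminorm_le : forall f, seminorm_fun f <= `|f| }.

Section interpolation.
Context {R : realType} {X : completeNormedModType R}.
Variable s : dual_seminorm X.
Implicit Types (f g : dual X) (x y : X) (k n : nat).

Let lam n : R := 4^-1 ^+ n.+1.
Let w n : R := 2^-1 ^+ n.+1.

(* The support function of [(1 - lam n) K + lam n B_X]; [interp_gauge] is the
   corresponding Minkowski functional. *)
Definition interp_support n f : R := (1 - lam n) * s f + lam n * `|f|.

Definition interp_gauge n x : R :=
  sup [set `|f x| | f in [set f | interp_support n f <= 1]].

Definition interp_norm k x : R :=
  Num.sqrt (\sum_(n < k) w n * interp_gauge n x ^+ 2).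

Local Notation q := interp_support.
Local Notation p := interp_gauge.
Local Notation N := interp_norm.

Let lam_gt0 n : 0 < lam n. Proof. by rewrite exprn_gt0 ?invr_gt0. Qed.
Let w_gt0 n : 0 < w n. Proof. by rewrite exprn_gt0 ?invr_gt0. Qed.
Let w_ge0 n : 0 <= w n. Proof. exact: ltW. Qed.
Let lam_le1 n : lam n <= 1.
Proof. by rewrite exprn_ile1 ?invr_ge0// invf_le1// ler1n. Qed.

Lemma interp_supportZ n a f : q n (a *: f) = `|a| * q n f.
Proof. by rewrite /q seminormZ normrZ; ring. Qed.

Lemma interp_support_le_norm n f : q n f <= `|f|.
Proof.
rewrite /q; have := seminorm_le s f; have := lam_le1 n; have := lam_gt0 n.
by move: (lam n) (s f) => l t; nra.
Qed.

Lemma interp_support_ge_norm n f : lam n * `|f| <= q n f.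
Proof. by rewrite /q lerDr mulr_ge0 ?seminorm_ge0// subr_ge0. Qed.

Lemma interp_support_ge_seminorm n f : s f <= q n f.
Proof.
rewrite /q; have := seminorm_le s f; have := lam_le1 n; have := lam_gt0 n.
by move: (lam n) (s f) => l t; nra.
Qed.

Lemma interp_support_le n f : q n f <= s f + lam n * `|f|.
Proof.
rewrite /q lerD2r ler_piMl ?seminorm_ge0//.
by rewrite lerBlDr lerDl ltW.
Qed.

Lemma interp_support0 n : q n 0 = 0.
Proof. by rewrite -(scale0r 0) interp_supportZ normr0 mul0r. Qed.

Let has_sup_gauge n x : has_sup [set `|f x| | f in [set f | q n f <= 1]].
Proof.
split; first by exists `|(0 : dual X) x|, 0 => //=; rewrite interp_support0.
exists ((lam n)^-1 * `|x|) => _ [f /= qf <-].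
rewrite (le_trans (dual_ler_norm _ _))// ler_wpM2r// -[leRHS]mulr1.
by rewrite ler_pdivlMl// (le_trans _ qf)// interp_support_ge_norm.
Qed.

Lemma interp_gauge_le n x c : (forall f, q n f <= 1 -> `|f x| <= c) -> p n x <= c.
Proof.
by move=> h; apply: ge_sup => [|_ [f qf <-]]; [case: (has_sup_gauge n x)|exact: h].
Qed.

Lemma interp_gauge_ge0 n x : 0 <= p n x.
Proof.
rewrite -(normr0 R); apply: sup_upper_bound => //.
by exists 0; [rewrite /= interp_support0|].
Qed.

Lemma interp_gauge_ub n f x : `|f x| <= q n f * p n x.
Proof.
have [->|f0] := eqVneq f 0.
  by rewrite interp_support0 mul0r normr0.
have qf : 0 < q n f.
  apply: lt_le_trans (interp_support_ge_norm _ _).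
  by rewrite mulr_gt0// normr_gt0.
rewrite -ler_pdivrMl// -{1}(gtr0_norm qf) -normfV -normrM.
apply: sup_upper_bound => //; exists ((q n f)^-1 *: f) => //=.
by rewrite interp_supportZ normfV gtr0_norm// mulVf// gt_eqF.
Qed.

Lemma interp_gaugeD n x y : p n (x + y) <= p n x + p n y.
Proof.
apply: interp_gauge_le => f qf; rewrite linearD (le_trans (ler_normD _ _))//.
by rewrite lerD// (le_trans (interp_gauge_ub n _ _))// ler_piMl// interp_gauge_ge0.
Qed.

Lemma interp_gaugeZ n a x : p n (a *: x) = `|a| * p n x.
Proof.
have le b y : p n (b *: y) <= `|b| * p n y.
  apply: interp_gauge_le => f qf; rewrite linearZ normrM ler_wpM2l//.
  by rewrite (le_trans (interp_gauge_ub n _ _))// ler_piMl// interp_gauge_ge0.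
apply/eqP; rewrite eq_le le/=.
have [->|a0] := eqVneq a 0; first by rewrite normr0 mul0r interp_gauge_ge0.
rewrite -ler_pdivlMl ?normr_gt0// -normfV.
by rewrite -{1}[x]scale1r -(mulVf a0) -scalerA le.
Qed.

Lemma interp_gauge_ge_norm n x : `|x| <= p n x.
Proof.
apply: dual_norm_point => f f1; rewrite (le_trans (ler_norm _))//.
rewrite (le_trans (interp_gauge_ub n _ _))// ler_piMl// ?interp_gauge_ge0//.
by rewrite (le_trans (interp_support_le_norm _ _)).
Qed.

Lemma interp_gauge_le_norm n x : p n x <= (lam n)^-1 * `|x|.
Proof.
apply: interp_gauge_le => f qf.
rewrite (le_trans (dual_ler_norm _ _))// ler_wpM2r// -[leRHS]mulr1.
by rewrite ler_pdivlMl// (le_trans _ qf)// interp_support_ge_norm.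
Qed.

Let S0 k x : 0 <= \sum_(n < k) w n * p n x ^+ 2.
Proof. by apply: sumr_ge0 => n _; rewrite mulr_ge0 ?sqr_ge0. Qed.

Lemma interp_norm_ge0 k x : 0 <= N k x.
Proof. exact: sqrtr_ge0. Qed.

Lemma interp_norm_sqr k x : N k x ^+ 2 = \sum_(n < k) w n * p n x ^+ 2.
Proof. by rewrite sqr_sqrtr. Qed.

Lemma interp_normS k x : N k.+1 x ^+ 2 = N k x ^+ 2 + w k * p k x ^+ 2.
Proof. by rewrite !interp_norm_sqr big_ord_recr. Qed.

Lemma interp_norm0 x : N 0 x = 0.
Proof. by rewrite /N big_ord0 sqrtr0. Qed.

Lemma interp_norm_le k x c : 0 <= c -> (N k x <= c) = (N k x ^+ 2 <= c ^+ 2).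
Proof. by move=> c0; rewrite ler_pXn2r// nnegrE ?interp_norm_ge0. Qed.

Lemma interp_norm_nd x : {homo N ^~ x : k l / (k <= l)%N >-> k <= l}.
Proof.
apply: homo_leq => [//|u v t|k]; first exact: le_trans.
rewrite interp_norm_le ?interp_norm_ge0// interp_normS lerDl.
by rewrite mulr_ge0 ?sqr_ge0.
Qed.

Lemma interp_normD k x y : N k (x + y) <= N k x + N k y.
Proof.
elim: k => [|k IH]; first by rewrite !interp_norm0 addr0.
rewrite interp_norm_le ?addr_ge0 ?interp_norm_ge0//.
have NE z : N k.+1 z = Num.sqrt (N k z ^+ 2 + w k * p k z ^+ 2).
  by rewrite -interp_normS sqrtr_sqr ger0_norm ?interp_norm_ge0.
rewrite interp_normS [N k.+1 x]NE [N k.+1 y]NE.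
apply: le_trans (ler_sqrt_sum2 _ _ _ _ (w_ge0 k)).
rewrite lerD//; first by rewrite -interp_norm_le ?addr_ge0 ?interp_norm_ge0.
by rewrite ler_wpM2l// ler_pXn2r ?interp_gaugeD// nnegrE ?addr_ge0 ?interp_gauge_ge0.
Qed.

Lemma interp_normZ k a x : N k (a *: x) = `|a| * N k x.
Proof.
rewrite /N -[`|a| in RHS](ger0_norm (normr_ge0 _)) -sqrtr_sqr -sqrtrM ?sqr_ge0//.
congr Num.sqrt; rewrite mulr_sumr; apply: eq_bigr => n _.
by rewrite interp_gaugeZ; ring.
Qed.

Lemma sum_half_powers k : \sum_(n < k) w n = 1 - 2^-1 ^+ k.
Proof.
elim: k => [|k IH]; first by rewrite big_ord0 expr0 subrr.
by rewrite big_ord_recr/= IH /w exprS; lra.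
Qed.

Lemma interp_norm_ge k x : (1 - 2^-1 ^+ k) * `|x| ^+ 2 <= N k x ^+ 2.
Proof.
rewrite -sum_half_powers interp_norm_sqr mulr_suml; apply: ler_sum => n _.
by rewrite ler_wpM2l// ler_pXn2r ?interp_gauge_ge_norm// nnegrE ?interp_gauge_ge0.
Qed.

(** The bound depends on [k]: each partial norm is continuous for the norm of [X], although their
    supremum need not be. Limits taken in [X] therefore pass to [N k] at fixed [k]. *)
Lemma interp_norm_bounded k : exists2 C, 0 <= C & forall x, N k x <= C * `|x|.
Proof.
pose C := \sum_(n < k) w n * (lam n)^-1 ^+ 2.
have C0 : 0 <= C by apply: sumr_ge0 => n _; rewrite mulr_ge0 ?sqr_ge0.
exists (Num.sqrt C) => [|x]; first exact: sqrtr_ge0.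
rewrite interp_norm_le ?mulr_ge0 ?sqrtr_ge0// interp_norm_sqr exprMn.
rewrite sqr_sqrtr// mulr_suml; apply: ler_sum => n _; rewrite -mulrA -exprMn.
rewrite ler_wpM2l// ler_pXn2r ?interp_gauge_le_norm// nnegrE ?interp_gauge_ge0//.
by rewrite mulr_ge0// invr_ge0 ltW.
Qed.

(** Termwise [(a + b) ^+ 2 <= 2 * a ^+ 2 + 2 * b ^+ 2]. A perturbation [y] thus enters the tail only
    quadratically, which is the benefit of the squares in [interp_norm]. *)
Lemma interp_norm_tail k l x y : (k <= l)%N ->
  N l (x + y) ^+ 2 - N k (x + y) ^+ 2 <=
  2 * (N l x ^+ 2 - N k x ^+ 2) + 2 * N l y ^+ 2.
Proof.
move=> kl; rewrite !interp_norm_sqr -(subnKC kl).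
rewrite !big_split_ord/= !(addrC (\sum_(i < k) _)) !addrK.
apply: (@le_trans _ _ (\sum_(i < l - k) (2 * (w (k + i) * p (k + i) x ^+ 2) +
  2 * (w (k + i) * p (k + i) y ^+ 2)))).
  apply: ler_sum => i _; move: (k + i)%N => n.
  rewrite !(mulrCA 2) -mulrDr ler_wpM2l//.
  apply: (@le_trans _ _ ((p n x + p n y) ^+ 2)).
    by rewrite ler_pXn2r ?interp_gaugeD// nnegrE ?addr_ge0 ?interp_gauge_ge0.
  by have := sqr_ge0 (p n x - p n y); lra.
rewrite big_split/= -!mulr_sumr lerD2l ler_wpM2l// lerDl; exact: S0.
Qed.

Lemma interp_norm_le_seminorm k x c : 0 <= c ->
  (forall f, `|f x| <= c * s f) -> N k x <= c.
Proof.
move=> c0 xs; rewrite interp_norm_le// interp_norm_sqr.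
apply: (@le_trans _ _ (\sum_(n < k) w n * c ^+ 2)).
  apply: ler_sum => n _; rewrite ler_wpM2l//.
  rewrite ler_pXn2r ?nnegrE ?interp_gauge_ge0//.
  apply: interp_gauge_le => f qf; rewrite (le_trans (xs f))// ler_piMr//.
  by rewrite (le_trans (interp_support_ge_seminorm n f)).
rewrite -mulr_suml sum_half_powers ler_piMl ?sqr_ge0//.
Qed.

Lemma interp_norm_dual n f x : `|f x| <= (s f + lam n * `|f|) * (2 ^+ n.+1 * N n.+1 x).
Proof.
rewrite (le_trans (interp_gauge_ub n _ _))//.
(* Only the [n]-th term of the sum is kept, and [w n ^+ 2 <= w n] trades the square root of the
   weight for the weight itself. *)
have pN : p n x <= 2 ^+ n.+1 * N n.+1 x.
  rewrite -ler_pdivrMl ?exprn_gt0// -exprVn -/(w n).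
  rewrite -(@ler_pXn2r _ 2)// ?nnegrE ?mulr_ge0 ?interp_norm_ge0 ?interp_gauge_ge0//.
  apply: (@le_trans _ _ (w n * p n x ^+ 2)); last first.
    by rewrite interp_normS lerDr sqr_ge0.
  rewrite exprMn ler_wpM2r ?sqr_ge0// expr2 ler_piMr//.
  by rewrite exprn_ile1 ?invr_ge0// invf_le1// ler1n.
apply: (@le_trans _ _ (q n f * (2 ^+ n.+1 * N n.+1 x))).
  by rewrite ler_wpM2l// (le_trans _ (interp_support_ge_seminorm n f))// seminorm_ge0.
rewrite ler_wpM2r ?interp_support_le//.
by rewrite mulr_ge0 ?interp_norm_ge0 ?exprn_ge0.
Qed.

End interpolation.

(** * The interpolation space as a Banach space *)

Section interp_space.
Context {R : realType} {X : completeNormedModType R}.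
Variable s : dual_seminorm X.

Local Notation N := (interp_norm s).

(** Convergence of the series is encoded as boundedness of its nondecreasing partial norms, and the
    norm of [Y] as their supremum; estimates are then made one level [k] at a time. *)
Definition interp_pred : {pred X} :=
  mem [set x : X | exists C, forall k, N k x <= C].

Lemma interp_pred_submod : submod_closed interp_pred.
Proof.
split; first by rewrite inE; exists 0 => k; rewrite -(scale0r 0) interp_normZ normr0 mul0r.
move=> a x y; rewrite !inE => -[C xC] [D yD]; exists (`|a| * C + D) => k.
by rewrite (le_trans (interp_normD _ _ _ _))// lerD// interp_normZ ler_wpM2l.
Qed.

HB.instance Definition _ := GRing.isSubmodClosed.Build R X interp_pred
  interp_pred_submod.

Record interp_space : Type :=
  InterpSpace { interp_val :> X; _ : interp_val \in interp_pred }.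

HB.instance Definition _ := [isSub for interp_val].
HB.instance Definition _ := [Choice of interp_space by <:].
HB.instance Definition _ := [SubChoice_isSubLmodule of interp_space by <:].

Implicit Types (y z : interp_space).

Lemma interp_val_linear : linear interp_val.
Proof. by []. Qed.

HB.instance Definition _ := GRing.isLinear.Build R interp_space X *:%R
  interp_val interp_val_linear.

Definition interp_space_norm y : R := sup (range (fun k => N k (y : X))).

Lemma interp_space_norm_ub y k : N k y <= interp_space_norm y.
Proof.
apply: sup_upper_bound; last by exists k.
split; first by exists (N 0%N y), 0%N.
have [C yC] : exists C, forall k, N k y <= C by case: (y) => x /= /[!inE].
by exists C => _ [l _ <-].
Qed.

Lemma interp_space_norm_le y c : (forall k, N k y <= c) -> interp_space_norm y <= c.
Proof.
move=> yc; apply: ge_sup; first by exists (N 0%N y), 0%N.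
by move=> _ [k _ <-].
Qed.

Let normD y z : interp_space_norm (y + z) <= interp_space_norm y + interp_space_norm z.
Proof.
apply: interp_space_norm_le => k.
by rewrite linearD (le_trans (interp_normD _ _ _ _))// lerD// interp_space_norm_ub.
Qed.

Let normZ (a : R) y : interp_space_norm (a *: y) = `|a| * interp_space_norm y.
Proof.
have le b z : interp_space_norm (b *: z) <= `|b| * interp_space_norm z.
  apply: interp_space_norm_le => k; rewrite linearZ interp_normZ ler_wpM2l//.
  exact: interp_space_norm_ub.
apply/eqP; rewrite eq_le le/=.
have [->|a0] := eqVneq a 0.
  by rewrite normr0 mul0r (le_trans (interp_norm_ge0 s 0 _) (interp_space_norm_ub _ 0)).
rewrite -ler_pdivlMl ?normr_gt0// -normfV.
by rewrite -{1}[y]scale1r -(mulVf a0) -scalerA le.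
Qed.

Let norm_ge y : `|interp_val y| <= interp_space_norm y.
Proof.
have n0 : 0 <= interp_space_norm y.
  exact: le_trans (interp_norm_ge0 s 0 y) (interp_space_norm_ub _ 0).
rewrite -(@ler_pXn2r _ 2)// ?nnegrE//.
(* The first [k] weights sum only to [1 - 2^-k], hence the passage to the limit in [k]. *)
have h k : (1 - 2^-1 ^+ k) * `|y : X| ^+ 2 <= interp_space_norm y ^+ 2.
  apply: le_trans (interp_norm_ge s k y) _.
  by rewrite ler_pXn2r ?nnegrE ?interp_norm_ge0// interp_space_norm_ub.
have : (fun k => (1 - 2^-1 ^+ k) * `|y : X| ^+ 2 : R^o) @ \oo -->
    ((1 - 0) * `|y : X| ^+ 2 : R^o).
  apply: cvgMl; apply: cvgB; first exact: cvg_cst.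
  by apply: cvg_expr; rewrite ger0_norm ?invr_ge0// invf_lt1// ltr1n.
rewrite subr0 mul1r => hc.
apply: (closed_cvg _ (@closed_le _ (interp_space_norm y ^+ 2)) _ _ hc).
exact: nearW.
Qed.

Let norm_eq0 y : interp_space_norm y = 0 -> y = 0.
Proof.
move=> y0; apply/val_inj/eqP => /=; rewrite -normr_eq0 eq_le normr_ge0 andbT.
by rewrite -y0 norm_ge.
Qed.

HB.instance Definition _ := Lmodule_isNormed.Build R interp_space
  normD normZ norm_eq0.

Lemma interp_norm_le_norm y k : N k y <= `|y|.
Proof. exact: interp_space_norm_ub. Qed.

Lemma interp_space_le y c : (forall k, N k y <= c) -> `|y| <= c.
Proof. exact: interp_space_norm_le. Qed.

Lemma interp_val_norm y : `|interp_val y| <= `|y|.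
Proof. exact: norm_ge. Qed.

Lemma interp_val_surj x c : (forall k, N k x <= c) ->
  exists2 y : interp_space, interp_val y = x & `|y| <= c.
Proof.
move=> xc; have xP : x \in interp_pred by rewrite inE; exists c.
by exists (InterpSpace xP) => //; exact: interp_space_le.
Qed.

Lemma interp_val_lift x c : 0 <= c -> (forall f : dual X, `|f x| <= c * s f) ->
  exists2 y : interp_space, interp_val y = x & `|y| <= c.
Proof.
by move=> c0 xs; apply: interp_val_surj => k; exact: interp_norm_le_seminorm.
Qed.

(** The limit [x] is taken in [X]. At each fixed level [k] the Cauchy estimate passes to [x] by
    continuity of [N k], with a bound independent of [k]; this puts [x] in [Y] and gives convergence
    there. *)
Lemma interp_space_complete (F : set_system interp_space) :
  ProperFilter F -> cauchy F -> cvg F.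
Proof.
move=> PF cF.
have cF' e : 0 < e -> exists y, F [set z | `|y - z| <= e].
  move=> e0; have /cauchyP/(_ _ e0)[f Ff] := cF.
  by exists f; apply: filterS Ff => g; rewrite -ball_normE => /ltW.
have cJ : cvg (interp_val @ F).
  apply: cauchy_cvg; apply: cauchy_exP => e e0.
  have [|y Fy] := cF' (e / 2); first by rewrite divr_gt0.
  exists (interp_val y); rewrite fmapE; apply: (filterS _ Fy) => z /= yz.
  rewrite -ball_normE /ball_/= -linearB (le_lt_trans (interp_val_norm _))//.
  by rewrite (le_lt_trans yz)// ltr_pdivrMr// ltr_pMr// ltr1n.
pose x := lim (interp_val @ F).
have xF e y k : F [set z | `|y - z| <= e] -> N k (interp_val y - x) <= e.
  move=> Fy; have [C C0 NC] := interp_norm_bounded s k.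
  apply/ler_addgt0Pl => r r0.
  have rC : 0 < r / (C + 1) by rewrite divr_gt0// ltr_wpDl.
  have /cvgrPdist_le/(_ _ rC) xz := cJ.
  have [z [/= yz {}xz]] := filter_ex (filterI Fy xz).
  rewrite (_ : _ - x = interp_val (y - z) + - (x - interp_val z)); last first.
    by rewrite linearB/= opprB [RHS]addrA subrK.
  rewrite (le_trans (interp_normD _ _ _ _))// addrC lerD//; last first.
    by rewrite (le_trans (interp_norm_le_norm _ _)).
  rewrite -scaleN1r interp_normZ normrN1 mul1r (le_trans (NC _))//.
  apply: (@le_trans _ _ ((C + 1) * (r / (C + 1)))).
    by rewrite ler_pM// lerDl.
  by rewrite mulrC divfK// gt_eqF// ltr_wpDl.
have [y1 Fy1] := cF' 1 ltr01.
have [u ux _] : exists2 u : interp_space, interp_val u = x & `|u| <= `|y1| + 1.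
  apply: interp_val_surj => k.
  rewrite (_ : x = interp_val y1 + (-1) *: (interp_val y1 - x)); last first.
    by rewrite scaleN1r opprB addrC subrK.
  rewrite (le_trans (interp_normD _ _ _ _))// lerD// ?interp_norm_le_norm//.
  by rewrite interp_normZ normrN1 mul1r xF.
apply/cvg_ex; exists u; apply/cvgrPdist_le => e e0.
have [|y Fy] := cF' (e / 2); first by rewrite divr_gt0.
apply: (filterS _ (Fy)) => z /= yz.
have -> : u - z = (u - y) + (y - z) by rewrite addrA subrK.
rewrite (splitr e) (le_trans (ler_normD _ _))// lerD//.
by rewrite distrC; apply: interp_space_le => k; rewrite linearB/= ux xF.
Qed.

HB.instance Definition _ := Uniform_isComplete.Build interp_space
  interp_space_complete.

End interp_space.

Lemma half_power_lt (R : realType) (C e : R) : 0 < e ->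
  exists n, C * 2^-1 ^+ n.+1 < e.
Proof.
move=> e0; have : (fun n => C * 2^-1 ^+ n : R^o) @ \oo --> (C * 0 : R^o).
  apply: cvgMr; apply: cvg_expr.
  by rewrite ger0_norm ?invr_ge0// invf_lt1// ltr1n.
rewrite mulr0 => /cvgrPdist_lt/(_ _ e0)[n _ /(_ n.+1 (leqnSn _))].
by rewrite /= sub0r normrN => h; exists n; exact: le_lt_trans (ler_norm _) h.
Qed.

(** * Density in the dual and reflexivity of the interpolation space *)

Section dual_pullback.
Context {R : realType} {Y X : normedModType R} {J : {linear Y -> X}}.
Variable cJ : continuous J.

Lemma dual_pullback_subproof (g : dual X) :
  (g \o J : Y -> R^o) \in @continuous_functional R Y.
Proof.
apply: mem_set; split; first by move=> a u v; rewrite /= !linearP.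
by move=> y; apply: continuous_comp; [exact: cJ|exact: dual_continuous].
Qed.

Definition dual_pullback (g : dual X) : dual Y := Dual (dual_pullback_subproof g).

Lemma dual_pullbackE g y : dual_pullback g y = g (J y).
Proof. by []. Qed.

Lemma dual_pullback_linear : linear dual_pullback.
Proof. by move=> a f g; exact/val_inj/funext. Qed.

End dual_pullback.

Section interp_reflexive.
Context {R : realType} {X : completeNormedModType R}.
Variable s : dual_seminorm X.
Local Notation Y := (interp_space s).
Local Notation J := (@interp_val R X s).
Local Notation N := (interp_norm s).

Lemma interp_val_continuous : continuous J.
Proof.
apply/linear_bounded_continuous/linear_boundedP.
exists 1; split=> [|t /ltW t1 y]; first exact: num_real.
by rewrite (le_trans (interp_val_norm _))// ler_peMl.
Qed.

Lemma interp_val_inj : injective J.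
Proof. exact: val_inj. Qed.

Local Notation pull := (dual_pullback interp_val_continuous).

(* On bounded subsets of [Y], functionals on [Y] are continuous for the norm of
   [X]: perturb an almost norming vector [z] of [f] by [t y] and use that the
   square of the norm only grows by [O(t ^ 2)] in the tail. *)
Lemma interp_dual_small (f : dual Y) e : 0 < e ->
  exists2 C, 0 <= C & forall y, f y <= e * `|y| + C * `|J y|.
Proof.
(* The denominator [2 * M + 1] comes from the end: [f z >= M - t ^+ 2] and
   [|z + t *: u| <= 1 + a + 2 * t ^+ 2] give [t * f u <= M * a + (2 * M + 1) * t ^+ 2], and division
   by [t] must leave [e]. *)
move=> e0; pose M := `|f|; pose t := e / (2 * M + 1).
have M1 : 0 < 2 * M + 1 by rewrite ltr_wpDl// mulr_ge0// normr_ge0.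
have t0 : 0 < t by rewrite divr_gt0.
have t2 : 0 < t ^+ 2 by rewrite exprn_gt0.
have [z z1 fz] : exists2 z, `|z| <= 1 & M - t ^+ 2 <= f z.
  have [|_ [z /= z1 <-] Mz] := @sup_adherent R [set `|f z| | z in [set z | `|z| <= 1]] _ t2.
    split; first by exists `|f 0|, 0 => //=; rewrite normr0.
    by exists `|f| => _ [y /= y1 <-]; exact: dual_norm_ub.
  rewrite -dual_normE in Mz; have [fz|fz] := leP 0 (f z).
    by exists z => //; rewrite ger0_norm// in Mz; exact: ltW.
  by exists (- z); rewrite ?normrN// linearN; rewrite ltr0_norm// in Mz; exact: ltW.
(* Beyond level [k] the partial norms of [z] lie within [t ^+ 2 / 2] of each other and are at most
   [1], so their squares differ by at most [t ^+ 2]. *)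
have [k zk] : exists k, `|z| - t ^+ 2 / 2 < N k z.
  have [||_ [k _ <-] kz] := @sup_adherent R (range (fun k => N k (J z))) (t ^+ 2 / 2).
  - by rewrite divr_gt0.
  - split; first by exists (N 0%N z), 0%N.
    by exists `|z| => _ [k _ <-]; exact: interp_norm_le_norm.
  - by exists k.
have Nz l : N l z <= 1 by rewrite (le_trans (interp_norm_le_norm _ _)).
have tail l : N l z ^+ 2 - N k z ^+ 2 <= t ^+ 2.
  have := interp_norm_le_norm z l; have := interp_norm_ge0 s l z.
  have := interp_norm_ge0 s k z; have := Nz k; move: zk z1 t2.
  move: (N l z) (N k z) (t ^+ 2) `|z| => a b c d; nra.
have [D D0 ND] := interp_norm_bounded s k.
have MD0 : 0 <= M * D by rewrite mulr_ge0// normr_ge0.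
exists (M * D) => // y.
suff H u : `|u| <= 1 -> f u <= e + M * D * `|J u|.
  have [->|y0] := eqVneq y 0.
    by rewrite !linear0 !normr0 !mulr0 addr0.
  have y0' : 0 < `|y| by rewrite normr_gt0.
  have := H (`|y|^-1 *: y); rewrite normrZ normfV normr_id mulVf ?gt_eqF//.
  move=> /(_ (lexx _)); rewrite !linearZ/= normrZ normfV normr_id.
  rewrite ler_pdivrMl// => /le_trans; apply.
  by rewrite mulrDr mulrC lerD2l mulrCA mulVKf ?gt_eqF.
move=> u1; pose a := t * (D * `|J u|).
have a0 : 0 <= a by rewrite mulr_ge0 ?(ltW t0)// mulr_ge0.
have Nk : N k (J z + J (t *: u)) <= 1 + a.
  rewrite (le_trans (interp_normD _ _ _ _))// lerD//.
  by rewrite linearZ interp_normZ gtr0_norm// ler_wpM2l// ltW.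
(* Up to level [k] the perturbation is measured in [X] through [D], which gives [1 + a]; the tail
   adds at most [4 * t ^+ 2] to the square, and [(1 + a) ^+ 2 + 4 * t ^+ 2 <= (1 + a + 2 * t ^+ 2)
   ^+ 2]. *)
have zu : `|z + t *: u| <= 1 + a + 2 * t ^+ 2.
  apply: interp_space_le => l; rewrite linearD.
  have aux : N (maxn k l) (J z + J (t *: u)) <= 1 + a + 2 * t ^+ 2.
    rewrite interp_norm_le; last by rewrite !addr_ge0// mulr_ge0// sqr_ge0.
    have := interp_norm_tail s (J z) (J (t *: u)) (leq_maxl k l).
    have := tail (maxn k l).
    have : N (maxn k l) (J (t *: u)) ^+ 2 <= t ^+ 2.
      rewrite linearZ interp_normZ gtr0_norm// exprMn ler_piMr ?(ltW t2)//.
      rewrite exprn_ile1 ?interp_norm_ge0//.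
      by rewrite (le_trans (interp_norm_le_norm _ _)).
    have : N k (J z + J (t *: u)) ^+ 2 <= (1 + a) ^+ 2.
      by rewrite ler_pXn2r// nnegrE ?interp_norm_ge0// addr_ge0.
    have := mulr_ge0 (ltW t2) a0; have := sqr_ge0 (t ^+ 2).
    move: (t ^+ 2) (N k (_ + _) ^+ 2) => c b; lra.
  by apply: (le_trans _ aux); apply: interp_norm_nd; exact: leq_maxr.
have : f (z + t *: u) <= M * (1 + a + 2 * t ^+ 2).
  by rewrite (le_trans (dual_le _ _))// ler_wpM2l// normr_ge0.
rewrite linearD linearZ/= => fzu.
have et : e = (2 * M + 1) * t by rewrite /t mulrC divfK// gt_eqF.
have : t * f u <= t * (e + M * D * `|J u|).
  have -> : t * (e + M * D * `|J u|) = (2 * M + 1) * t ^+ 2 + M * a.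
    by rewrite et /a; ring.
  by move: fzu fz; rewrite /GRing.scale/=; lra.
by rewrite ler_pM2l.
Qed.

(** Hahn-Banach on [X] for [C * |x|] against [e * |y| - f y] on the range of [J]; their
    compatibility is exactly [interp_dual_small]. The first bound makes the functional continuous on
    [X], the second makes its pullback [e]-close to [f]. *)
Lemma interp_dual_dense (f : dual Y) e : 0 < e ->
  exists g : dual X, `|f - pull g| <= e.
Proof.
move=> e0; have [C C0 fC] := interp_dual_small f e0.
(* [insubd] inverts [J] on its range; the default [0] elsewhere is never met, as [k] is used on the
   range only. *)
pose k (x : X) : R := e * `|insubd (0 : Y) x| - f (insubd (0 : Y) x).
have kE y : k (J y) = e * `|y| - f y by rewrite /k valKd.
have [| | |g [gC gk]] := @hahn_banach R X (fun x => C * `|x|) (range J) k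
  (sublinear_norm C0).
- split; first by exists 0; rewrite ?linear0.
    by move=> _ _ [y _ <-] [z _ <-]; exists (y + z); rewrite ?linearD.
  by move=> a _ _ [y _ <-]; exists (a *: y); rewrite ?linearZ.
- split=> [_ _ [y _ <-] [z _ <-]|a _ a0 [y _ <-]].
    rewrite -linearD !kE linearD; have := ler_normD y z.
    by rewrite -(ler_pM2l e0); lra.
  by rewrite -linearZ !kE linearZ normrZ ger0_norm//= /GRing.scale/=; ring.
- by move=> _ [y _ <-]; rewrite kE; have := fC y; lra.
have [|h hg] := @bounded_dual _ _ g C.
  move=> u; rewrite ler_norml gC andbT lerNl -linearN.
  by rewrite (le_trans (gC _))// normrN.
exists h; apply: dual_norm_ler; first exact: ltW.
have le y : f y - h (J y) <= e * `|y|.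
  by have := gk (J y); rewrite kE hg => /(_ (ex_intro2 _ _ y I erefl)); lra.
move=> y; rewrite dualD dualN dual_pullbackE ler_norml le andbT.
by have := le (- y); rewrite linearN !dual_oppr normrN; lra.
Qed.

(** Density in the form used for reflexivity and for the lifted integrals, with [L] the difference
    of the two sides to be identified. *)
Lemma interp_dual_density (L : dual Y -> R) C :
  (forall f g, `|L f - L g| <= C * `|f - g|) -> (forall g, L (pull g) = 0) ->
  forall f, L f = 0.
Proof.
move=> LC L0 f; apply/eqP; rewrite -normr_eq0 eq_le normr_ge0 andbT.
apply/ler_addgt0Pl => e e0; rewrite addr0.
have C1 : 0 < `|C| + 1 by rewrite ltr_wpDl.
have [|g fg] := @interp_dual_dense f (e / (`|C| + 1)); first by rewrite divr_gt0.
have := LC f (pull g); rewrite L0 subr0 => /le_trans; apply.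
apply: (@le_trans _ _ ((`|C| + 1) * (e / (`|C| + 1)))).
  by rewrite (le_trans (ler_wpM2r _ (ler_norm C)))// ler_pM// lerDl.
by rewrite mulrC divfK// gt_eqF.
Qed.

(** The coefficient of [|g|] is [2^-(n+1)], small for large [n]. That of [s g] grows, which is
    harmless because [s_repr] accepts every multiple of [s]. *)
Lemma interp_pull_norm n g : `|pull g| <= (s g + 4^-1 ^+ n.+1 * `|g|) * 2 ^+ n.+1.
Proof.
apply: dual_norm_ler => [|y].
  by rewrite mulr_ge0 ?addr_ge0 ?mulr_ge0 ?exprn_ge0 ?invr_ge0// ?seminorm_ge0.
rewrite dual_pullbackE (le_trans (interp_norm_dual s n _ _))// mulrA.
rewrite ler_wpM2l ?interp_norm_le_norm//.
by rewrite mulr_ge0 ?addr_ge0 ?mulr_ge0 ?exprn_ge0 ?invr_ge0// ?seminorm_ge0.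
Qed.

Hypothesis s_repr : forall (psi : {linear dual X -> R^o}) c, 0 <= c ->
  (forall f, psi f <= c * s f) -> exists x, forall f, psi f = f x.

Lemma interp_reflexive : reflexive_space Y.
Proof.
move=> phi.
pose psi0 (g : dual X) : R^o := phi (pull g).
have lpsi : linear psi0.
  by move=> a f g; rewrite /psi0 dual_pullback_linear linearP.
pose psi : {linear dual X -> R^o} := HB.pack psi0
  (GRing.isLinear.Build R (dual X) R^o *:%R psi0 lpsi).
have psiE g : psi g = phi (pull g) by [].
pose d n : R := `|phi| * 2^-1 ^+ n.+1.
have d0 n : 0 <= d n by rewrite mulr_ge0// exprn_ge0// invr_ge0.
have : forall n, exists x : X, forall g, `|psi g - g x| <= d n * `|g|.
  move=> n; pose c : R := `|phi| * 2 ^+ n.+1.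
  have c0 : 0 <= c by rewrite mulr_ge0// exprn_ge0.
  have ss : sublinear_on setT (fun g => c * s g).
    split=> [u v _ _|a u a0 _]; first by rewrite -mulrDr ler_wpM2l// seminormD.
    by rewrite seminormZ ger0_norm// mulrCA.
  (* The part of [psi] dominated by [c * s] is represented by a vector through [s_repr]; what
     remains is bounded by [d n] times the norm. *)
  have [|psi1 [psi1c psi1d]] := @linear_sub_sum _ _ psi _ _ ss (sublinear_norm (d0 n)).
    move=> g; rewrite psiE (le_trans (dual_le _ _))//.
    rewrite (le_trans (ler_wpM2l _ (interp_pull_norm n g)))//.
    have h : 4^-1 ^+ n.+1 * 2 ^+ n.+1 = 2^-1 ^+ n.+1 :> R.
      by rewrite -exprMn (_ : 4^-1 * 2 = 2^-1 :> R)//; field.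
    rewrite le_eqVlt; apply/orP; left; apply/eqP; rewrite /c /d -h; ring.
  have [x psi1x] := s_repr c0 psi1c.
  exists x => g; rewrite -psi1x ler_norml psi1d andbT lerNl.
  by have := psi1d (- g); rewrite (linearN psi) (linearN psi1) normrN; lra.
move=> /choice[k kP].
have kk n m : `|k n - k m| <= d n + d m.
  apply: dual_norm_point => g g1; rewrite linearB/=.
  have := kP n g; have := kP m g; rewrite !ler_norml.
  have : d n * `|g| <= d n by rewrite ler_piMr.
  have : d m * `|g| <= d m by rewrite ler_piMr.
  lra.
have dnd n m : (n <= m)%N -> d m <= d n.
  by move=> nm; rewrite ler_wpM2l// ler_wiXn2l ?invr_ge0// invf_le1// ler1n.
have ck : cvg (k @ \oo).
  apply: cauchy_cvg; apply: cauchy_exP => e e0.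
  have [|n ne] := half_power_lt `|phi| (_ : 0 < e / 2); first by rewrite divr_gt0.
  exists (k n); exists n => // m /= nm.
  rewrite -ball_normE /ball_/= (le_lt_trans (kk n m))//.
  by have := dnd _ _ nm; move: ne; rewrite -/(d n); lra.
pose x := lim (k @ \oo).
have kx n : `|k n - x| <= d n + d n.
  apply: (cvg_dist_le ck); exists n => // m /= nm.
  by rewrite (le_trans (kk n m))// lerD2l dnd.
have psix g : psi g = g x.
  apply/eqP; rewrite -subr_eq0 -normr_eq0 eq_le normr_ge0 andbT.
  apply/ler_addgt0Pl => e e0; rewrite addr0.
  have [n ne] := half_power_lt (3 * (`|phi| * `|g|)) e0.
  apply: le_trans (ltW ne).
  rewrite (_ : _ - _ = (psi g - g (k n)) + g (k n - x)); last first.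
    by rewrite linearB/= addrA subrK.
  rewrite (le_trans (ler_normD _ _))//.
  have := kP n g; have := dual_ler_norm g (k n - x).
  have : `|g| * `|k n - x| <= `|g| * (d n + d n) by rewrite ler_wpM2l.
  by rewrite /d; lra.
(* To see that [x] lies in [Y], norm it at level [l] by some [g <= N l]. Then [pull g] has norm at
   most [1], so [N l x = g x = phi (pull g) <= |phi|] for every [l]. *)
have [y yx _] : exists2 y : Y, J y = x & `|y| <= `|phi|.
  apply: interp_val_surj => l.
  have [D D0 ND] := interp_norm_bounded s l.
  have [|g [gN gx]] := le_dual_norming x _ ND.
    split=> [u v _ _|a u a0 _]; first exact: interp_normD.
    by rewrite interp_normZ ger0_norm.
  rewrite -gx -psix psiE (le_trans (dual_le _ _))// ler_piMr//.
  apply: dual_norm_le => y y1; rewrite dual_pullbackE.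
  have le u : g (J u) <= `|u| by rewrite (le_trans (gN _))// interp_norm_le_norm.
  apply: le_trans y1; rewrite ler_norml le andbT lerNl -!linearN.
  by rewrite (le_trans (le _))// normrN.
exists y; suff h f : phi f - f y = 0 by move=> f; apply/eqP; rewrite -subr_eq0 h.
move: f; apply: (@interp_dual_density _ (`|phi| + `|y|)) => [f g|g]; last first.
  by rewrite -psiE psix -yx subrr.
rewrite (_ : _ - _ = phi (f - g) - (f - g) y); last first.
  by rewrite dual_subr (_ : (f - g) y = f y - g y)//; ring.
rewrite (le_trans (ler_normB _ _))// mulrDl lerD// ?dual_ler_norm//.
by rewrite (mulrC `|y|) dual_ler_norm.
Qed.

End interp_reflexive.

(** * Integrals with respect to a charge *)

Section charge_integral_theory.
Local Open Scope ereal_scope.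
Context d (T : measurableType d) (R : realType).
Implicit Types (mu : {charge set T -> \bar R}) (f g : T -> R) (A B D : set T).

Local Notation pos mu := (jordan_pos (hahn_setsP mu)).
Local Notation neg mu := (jordan_neg (hahn_setsP mu)).
Local Notation TV := charge_total_variation.

Definition cintegrable mu f := (TV mu).-integrable [set: T] (EFin \o f).

Lemma measurable_hahn mu :
  measurable (hahn_sets mu).1 /\ measurable (hahn_sets mu).2.
Proof. by have [[mP _] [mN _] _ _] := hahn_setsP mu. Qed.

Lemma hahn_pos_negE mu : (hahn_sets mu).2 = ~` (hahn_sets mu).1.
Proof.
have [_ _ PN PN0] := hahn_setsP mu; apply/seteqP; split => x.
  by move=> Nx Px; have : set0 x by rewrite -PN0.
by move=> nPx; have : [set: T] x by []; rewrite -PN => -[].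
Qed.

Lemma jordan_pos_hahn mu A : measurable A -> pos mu A = mu (A `&` (hahn_sets mu).1).
Proof. by move=> mA; rewrite jordan_posE cjordan_posE /crestr0 mem_set. Qed.

Lemma jordan_neg_hahn mu A : measurable A -> neg mu A = - mu (A `&` (hahn_sets mu).2).
Proof. by move=> mA; rewrite jordan_negE cjordan_negE /crestr0 mem_set. Qed.

Lemma jordan_pos_hahn2 mu : pos mu (hahn_sets mu).2 = 0.
Proof.
have [_ _ _ PN0] := hahn_setsP mu; have [_ mN] := measurable_hahn mu.
by rewrite jordan_pos_hahn// setIC PN0 charge0.
Qed.

Lemma jordan_neg_hahn1 mu : neg mu (hahn_sets mu).1 = 0.
Proof.
have [_ _ _ PN0] := hahn_setsP mu; have [mP _] := measurable_hahn mu.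
by rewrite jordan_neg_hahn// PN0 charge0 oppe0.
Qed.

Lemma charge_jordan mu A : measurable A -> mu A = pos mu A - neg mu A.
Proof. by move=> mA; rewrite (jordan_decomp (hahn_setsP mu) mA) /cadd/= cscaleN1. Qed.

Lemma TV_hahn mu A : measurable A ->
  TV mu A = mu (A `&` (hahn_sets mu).1) - mu (A `&` (hahn_sets mu).2).
Proof. by move=> mA; rewrite -jordan_pos_hahn// -jordan_neg_hahn. Qed.

Lemma TV_fin_num mu A : measurable A -> TV mu A \is a fin_num.
Proof. by move=> mA; rewrite fin_numD !fin_num_measure. Qed.

Lemma ge0_integral_TV mu D (h : T -> \bar R) : measurable D ->
  (forall x, D x -> 0 <= h x) -> measurable_fun D h ->
  \int[TV mu]_(x in D) h x = \int[pos mu]_(x in D) h x + \int[neg mu]_(x in D) h x.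
Proof.
move=> mD h0 mh; rewrite -ge0_integral_measure_add//.
apply: eq_measure_integral => A mA _; exact/esym/measure_addE.
Qed.

Lemma measurable_EFin_norm f D : measurable_fun setT f ->
  measurable_fun D (fun x => `|f x|%:E).
Proof.
move=> mf; apply: measurable_funTS; apply/measurable_EFinP.
exact: measurableT_comp.
Qed.

Lemma cintegrableP mu f : measurable_fun setT f ->
  \int[TV mu]_x `|f x|%:E < +oo -> cintegrable mu f.
Proof. by move=> mf foo; apply/integrableP; split=> //; exact/measurable_EFinP. Qed.

Lemma cintegrable_pos mu f D : measurable D -> cintegrable mu f ->
  (pos mu).-integrable D (EFin \o f).
Proof.
move=> mD /integrableP[mf foo]; apply: (@integrableS _ _ _ _ setT) => //.
apply/integrableP; split=> //; apply: le_lt_trans foo.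
by rewrite ge0_integral_TV// ?leeDl ?integral_ge0//; exact: measurableT_comp.
Qed.

Lemma cintegrable_neg mu f D : measurable D -> cintegrable mu f ->
  (neg mu).-integrable D (EFin \o f).
Proof.
move=> mD /integrableP[mf foo]; apply: (@integrableS _ _ _ _ setT) => //.
apply/integrableP; split=> //; apply: le_lt_trans foo.
by rewrite ge0_integral_TV// ?leeDr ?integral_ge0//; exact: measurableT_comp.
Qed.

Lemma cintegrable_bounded mu f C : measurable_fun setT f ->
  (forall x, `|f x| <= C)%R -> cintegrable mu f.
Proof.
move=> mf fC; apply: measurable_bounded_integrable => //.
  by rewrite ltey_eq TV_fin_num.
by exists C; split; [exact: num_real|move=> M CM x _; exact: le_trans (fC x) (ltW CM)].
Qed.

Lemma cintegrableD mu a f g : cintegrable mu f -> cintegrable mu g ->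
  cintegrable mu (fun x => a * f x + g x)%R.
Proof.
move=> If Ig; rewrite /cintegrable.
have -> : EFin \o (fun x => a * f x + g x)%R =
  (fun x => a%:E * (EFin \o f) x) \+ (EFin \o g) by apply/funext.
by apply: integrableD => //; exact: integrableZl.
Qed.

Lemma charge_integral_fin_num mu f D : measurable D -> cintegrable mu f ->
  charge_integral mu D f \is a fin_num.
Proof.
move=> mD If; rewrite /charge_integral fin_numB.
by apply/andP; split; apply: integrable_fin_num => //;
  [exact: cintegrable_pos|exact: cintegrable_neg].
Qed.

Lemma charge_integralD mu a f g D : measurable D ->
  cintegrable mu f -> cintegrable mu g ->
  charge_integral mu D (fun x => a * f x + g x)%R =
  a%:E * charge_integral mu D f + charge_integral mu D g.
Proof.
move=> mD If Ig; rewrite /charge_integral.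
have h (m : {measure set T -> \bar R}) :
    m.-integrable D (EFin \o f) -> m.-integrable D (EFin \o g) ->
    \int[m]_(x in D) (a * f x + g x)%:E =
    a%:E * \int[m]_(x in D) (f x)%:E + \int[m]_(x in D) (g x)%:E.
  move=> mf mg; rewrite -(integralZl mD mf) -integralD//; first exact: integrableZl.
have If1 := cintegrable_pos mD If; have Ig1 := cintegrable_pos mD Ig.
have If2 := cintegrable_neg mD If; have Ig2 := cintegrable_neg mD Ig.
rewrite !h//.
move: (integrable_fin_num mD If1) (integrable_fin_num mD Ig1).
move: (integrable_fin_num mD If2) (integrable_fin_num mD Ig2) => /=.
move: (\int[_]_(_ in _) _) (\int[_]_(_ in _) _) (\int[_]_(_ in _) _) (\int[_]_(_ in _) _).
move=> [x| |] [y| |] [z| |] [t| |] //= _ _ _ _.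
by rewrite -!(EFinM, EFinD, EFinN); congr EFin; ring.
Qed.

Lemma charge_integral_indic mu f B D : measurable B -> measurable D ->
  charge_integral mu D (fun x => f x * \1_B x)%R = charge_integral mu (D `&` B) f.
Proof.
move=> mB mD; rewrite /charge_integral.
have h (m : {measure set T -> \bar R}) :
    \int[m]_(x in D) (f x * \1_B x)%:E = \int[m]_(x in D `&` B) (f x)%:E.
  rewrite [LHS]integral_mkcond [RHS]integral_mkcond; apply: eq_integral => x _.
  rewrite /patch in_setI indicE; case: (x \in D) => //=.
  by case: (x \in B); rewrite ?mulr1 ?mulr0.
by rewrite !h.
Qed.

Lemma charge_integral_cst1 mu A : measurable A -> charge_integral mu A (cst 1%R) = mu A.
Proof.
move=> mA; rewrite /charge_integral charge_jordan//.
by congr (_ - _); rewrite -[RHS]mul1e -integral_cst.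
Qed.

Lemma le_abse_charge_integral mu f D : measurable D -> cintegrable mu f ->
  `|charge_integral mu D f| <= \int[TV mu]_x `|f x|%:E.
Proof.
move=> mD If; have /integrableP[mf _] := If.
have mf' : measurable_fun D (EFin \o f) by exact: measurable_funTS.
apply: (@le_trans _ _ (\int[TV mu]_(x in D) `|f x|%:E)); last first.
  by apply: ge0_subset_integral => //; exact/measurable_EFin_norm/measurable_EFinP.
rewrite ge0_integral_TV//; last exact/measurable_EFin_norm/measurable_EFinP.
rewrite /charge_integral (le_trans (lee_abs_sub _ _))//.
by apply: leeD; exact: le_abse_integral.
Qed.

(** [B] collects the points where [f] has the sign given by the Hahn decomposition. Integrals
    against the variation thus become signed integrals over two sets, which a vector integral can
    represent. *)
Lemma integral_TV_attained mu f : cintegrable mu f ->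
  exists2 B, measurable B & \int[TV mu]_x `|f x|%:E =
    charge_integral mu B f - charge_integral mu (~` B) f.
Proof.
move=> If; have /integrableP[/measurable_EFinP mf _] := If.
have [mP mN] := measurable_hahn mu.
set P := (hahn_sets mu).1 in mP; set N := (hahn_sets mu).2 in mN.
have NP : N = ~` P by exact: hahn_pos_negE.
pose F := [set x | 0 <= f x]%R.
have mF : measurable F.
  rewrite (_ : F = setT `&` f @^-1` `[0%R, +oo[%classic); first exact: mf.
  by apply/seteqP; split => x; rewrite /F/= in_itv/= andbT// => -[].
pose B := (F `&` P) `|` (~` F `&` ~` P).
have mB : measurable B.
  by apply: measurableU; apply: measurableI => //; exact: measurableC.
exists B => //; have mCB := measurableC mB.
rewrite ge0_integral_TV//; last exact: measurable_EFin_norm.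
have restr (m : {measure set T -> \bar R}) D Q (h : T -> \bar R) : measurable D ->
    measurable Q -> m (~` Q) = 0 -> m.-integrable setT h ->
    \int[m]_(x in D) h x = \int[m]_(x in D `&` Q) h x.
  move=> mD mQ mQ0 Ih; rewrite (negligible_integral (measurableC mQ) mD _ mQ0).
    by rewrite setDE setCK.
  exact: integrableS Ih.
have Ip := cintegrable_pos measurableT If; have In := cintegrable_neg measurableT If.
have Iap := integrable_abse Ip; have Ian := integrable_abse In.
have p0 : pos mu (~` P) = 0 by rewrite -NP jordan_pos_hahn2.
have n0 : neg mu (~` N) = 0 by rewrite NP setCK jordan_neg_hahn1.
have mFC := measurableC mF.
have BP : B `&` P = F `&` P.
  apply/seteqP; split=> x; first by move=> [[[]|[]]].
  by move=> [Fx Px]; split => //; left.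
have CBP : ~` B `&` P = ~` F `&` P.
  apply/seteqP; split=> x; first by move=> [nB Px]; split=> // Fx; apply: nB; left.
  by move=> [Fx Px]; split => // -[[]|[]].
have BN : B `&` N = ~` F `&` N.
  rewrite NP; apply/seteqP; split=> x; first by move=> [[[]|[]]].
  by move=> [Fx Px]; split => //; right.
have CBN : ~` B `&` N = F `&` N.
  rewrite NP; apply/seteqP; split=> x; last by move=> [Fx Px]; split => // -[[]|[]].
  by move=> [nB nPx]; split=> //; apply: contrapT => nF; apply: nB; right.
have FE (m : {measure set T -> \bar R}) : m.-integrable setT (EFin \o f) ->
    \int[m]_x `|f x|%:E = \int[m]_(x in F) (f x)%:E - \int[m]_(x in ~` F) (f x)%:E.
  move=> Im.
  rewrite -(setUv F) integral_setU//.
  - congr (_ + _); first by apply: eq_integral => x /[!inE] Fx; rewrite ger0_norm.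
    rewrite -integralN//=.
      apply: eq_integral => x /[!inE] /negP; rewrite -ltNge => Fx.
      by rewrite ltr0_norm.
    by apply: integrable_add_def => //; exact: integrableS Im.
  - exact: measurable_EFin_norm.
  - by rewrite disj_set2E setICr.
rewrite !FE// /charge_integral.
rewrite (restr (pos mu) F P)// (restr (pos mu) (~` F) P)//.
rewrite (restr (neg mu) F N)// (restr (neg mu) (~` F) N)//.
rewrite (restr (pos mu) B P)// (restr (pos mu) (~` B) P)//.
rewrite (restr (neg mu) B N)// (restr (neg mu) (~` B) N)//.
rewrite BP CBP BN CBN.
have fin (m : {measure set T -> \bar R}) A B' : measurable A -> measurable B' ->
  m.-integrable setT (EFin \o f) -> \int[m]_(x in A `&` B') (f x)%:E \is a fin_num.
  move=> mA mB' Im; apply: integrable_fin_num; first exact: measurableI.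
  by apply: integrableS Im => //; exact: measurableI.
have := fin _ _ _ mF mP Ip; have := fin _ _ _ mFC mP Ip.
have := fin _ _ _ mF mN In; have := fin _ _ _ mFC mN In.
move: (\int[_]_(_ in _) _) (\int[_]_(_ in _) _) (\int[_]_(_ in _) _) (\int[_]_(_ in _) _).
move=> [x| |] [y| |] [z| |] [t| |] //= _ _ _ _.
by rewrite -!(EFinD, EFinN); congr EFin; ring.
Qed.

End charge_integral_theory.

Section charge_congruence.
Local Open Scope ereal_scope.
Context d (T : measurableType d) (R : realType).
Implicit Types (mu : {charge set T -> \bar R}) (f : T -> R) (D : set T).

Local Notation pos mu := (jordan_pos (hahn_setsP mu)).
Local Notation neg mu := (jordan_neg (hahn_setsP mu)).

(** The Hahn sets are picked by choice, so charges agreeing on measurable sets may carry different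
    ones; uniqueness up to null sets identifies the Jordan parts. *)
Lemma jordan_congr mu1 mu2 : (forall A, measurable A -> mu1 A = mu2 A) ->
  forall A, measurable A -> pos mu1 A = pos mu2 A /\ neg mu1 A = neg mu2 A.
Proof.
move=> mu12 A mA.
have [mP1 mN1] := measurable_hahn mu1; have [mP2 mN2] := measurable_hahn mu2.
have h : hahn_decomposition mu1 (hahn_sets mu2).1 (hahn_sets mu2).2.
  have [[mP Pge] [mN Nle] PN PN0] := hahn_setsP mu2; split=> //; split=> // B mB BP.
    by rewrite mu12// Pge.
  by rewrite mu12// Nle.
have [hP hN] := Hahn_decomposition_uniq (hahn_setsP mu1) h mA.
rewrite !jordan_pos_hahn// !jordan_neg_hahn// hP hN !mu12//; exact: measurableI.
Qed.

Lemma integral_TV_congr mu1 mu2 : (forall A, measurable A -> mu1 A = mu2 A) ->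
  forall (h : T -> \bar R),
  \int[charge_total_variation mu1]_x h x = \int[charge_total_variation mu2]_x h x.
Proof.
move=> mu12 h; apply: eq_measure_integral => A mA _.
by have [h1 h2] := jordan_congr mu12 mA; congr (_ + _).
Qed.

Lemma charge_integral_congr mu1 mu2 : (forall A, measurable A -> mu1 A = mu2 A) ->
  forall D f, measurable D -> charge_integral mu1 D f = charge_integral mu2 D f.
Proof.
move=> mu12 D f mD; rewrite /charge_integral; congr (_ - _);
  by apply: eq_measure_integral => A mA _; have [] := jordan_congr mu12 mA.
Qed.

(** Jordan parts are not additive in general. Moving the negative parts across gives an equality of
    measures, [pos mu3 + neg mu1 + neg mu2 = neg mu3 + pos mu1 + pos mu2], which is integrated and
    rearranged. *)
Lemma charge_integral_add mu1 mu2 mu3 :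
  (forall A, measurable A -> mu3 A = mu1 A + mu2 A) ->
  forall D f, measurable D ->
  cintegrable mu1 f -> cintegrable mu2 f -> cintegrable mu3 f ->
  charge_integral mu3 D f = charge_integral mu1 D f + charge_integral mu2 D f.
Proof.
move=> mu123 D f mD I1 I2 I3.
have p1 := cintegrable_pos mD I1; have n1 := cintegrable_neg mD I1.
have p2 := cintegrable_pos mD I2; have n2 := cintegrable_neg mD I2.
have p3 := cintegrable_pos mD I3; have n3 := cintegrable_neg mD I3.
have add (m1 m2 : {measure set T -> \bar R}) : m1.-integrable D (EFin \o f) ->
    m2.-integrable D (EFin \o f) -> (measure_add m1 m2).-integrable D (EFin \o f).
  move=> /integrableP[mf i1] /integrableP[_ i2]; apply/integrableP; split=> //.
  rewrite ge0_integral_measure_add//; last exact: measurableT_comp.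
  by rewrite lte_add_pinfty.
have : \int[measure_add (pos mu3) (measure_add (neg mu1) (neg mu2))]_(x in D) (f x)%:E =
    \int[measure_add (neg mu3) (measure_add (pos mu1) (pos mu2))]_(x in D) (f x)%:E.
  have addE (m1 m2 m3 : {measure set T -> \bar R}) A :
      measure_add m1 (measure_add m2 m3) A = m1 A + (m2 A + m3 A).
    by rewrite (measure_addE m1); congr (_ + _); exact: measure_addE.
  apply: eq_measure_integral => A mA _.
  apply: etrans (addE _ _ _ A) (etrans _ (esym (addE _ _ _ A))).
  have := mu123 A mA.
  rewrite (charge_jordan mu1 mA) (charge_jordan mu2 mA) (charge_jordan mu3 mA).
  have fin (m : {finite_measure set T -> \bar R}) : m A = (fine (m A))%:E.
    by rewrite fineK// fin_num_measure.
  rewrite (fin (pos mu1)) (fin (pos mu2)) (fin (pos mu3)).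
  rewrite (fin (neg mu1)) (fin (neg mu2)) (fin (neg mu3)).
  rewrite -!EFinN -!EFinD => -[h].
  have fin3 (m1 m2 m3 : {finite_measure set T -> \bar R}) :
      m1 A + (m2 A + m3 A) = (fine (m1 A) + (fine (m2 A) + fine (m3 A)))%:E.
    by rewrite (fin m1) (fin m2) (fin m3).
  apply: etrans (fin3 _ _ _) (etrans _ (esym (fin3 _ _ _))).
  by congr EFin; lra.
have int3 (m1 m2 m3 : {measure set T -> \bar R}) : m1.-integrable D (EFin \o f) ->
    m2.-integrable D (EFin \o f) -> m3.-integrable D (EFin \o f) ->
    \int[measure_add m1 (measure_add m2 m3)]_(x in D) (f x)%:E =
    (fine (\int[m1]_(x in D) (f x)%:E) + (fine (\int[m2]_(x in D) (f x)%:E) +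
     fine (\int[m3]_(x in D) (f x)%:E)))%:E.
  move=> i1 i2 i3; apply: etrans (integral_measure_add mD i1 (add _ _ i2 i3)) _.
  rewrite !EFinD !fineK; [|exact: (integrable_fin_num mD)..].
  by congr (_ + _); exact: (integral_measure_add mD).
move=> E.
have [h] := etrans (esym (int3 _ _ _ p3 n1 n2)) (etrans E (int3 _ _ _ n3 p1 p2)).
rewrite /charge_integral -(fineK (integrable_fin_num mD p1)).
rewrite -(fineK (integrable_fin_num mD p2)) -(fineK (integrable_fin_num mD p3)).
rewrite -(fineK (integrable_fin_num mD n1)) -(fineK (integrable_fin_num mD n2)).
rewrite -(fineK (integrable_fin_num mD n3)) -!EFinN -!EFinD.
by congr EFin; move: h; rewrite /comp; lra.
Qed.

End charge_congruence.

(** * Integrals with respect to a vector measure *)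

Section vector_measure_theory.
Local Open Scope ereal_scope.
Context d (T : measurableType d) (R : realType) (Z : normedModType R).
Variable nu : vector_measure T Z.
Implicit Types (f g : T -> R) (A B D : set T) (z : dual Z).

Local Notation S := (scalarization nu).

Lemma vintegrable_cintegrable f z : vintegrable nu f -> cintegrable (S z) f.
Proof. by case=> mf foo _; exact: cintegrableP. Qed.

Lemma vintegralP f A z : vintegrable nu f -> measurable A ->
  (z (vintegral nu A f))%:E = charge_integral (S z) A f.
Proof.
move=> [_ _ h] mA; have [v vP] := h A mA.
by move: z; rewrite /vintegral; case: xgetP => [w _|/(_ v)/(_ vP)].
Qed.

Lemma is_vintegral_unique f A (v : Z) : is_vintegral nu A f v ->
  vintegral nu A f = v.
Proof.
move=> vP; rewrite /vintegral; case: xgetP => [w _ wP|/(_ v)/(_ vP)//].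
by apply: dual_separates => z; apply: EFin_inj; rewrite wP vP.
Qed.

Lemma vintegralD_subproof a f g A : vintegrable nu f -> vintegrable nu g ->
  measurable A -> is_vintegral nu A (fun x => a * f x + g x)%R
    (a *: vintegral nu A f + vintegral nu A g)%R.
Proof.
move=> If Ig mA z; rewrite charge_integralD//; try exact: vintegrable_cintegrable.
by rewrite -!vintegralP// dual_addr dual_scaler.
Qed.

Lemma vintegrableD a f g : vintegrable nu f -> vintegrable nu g ->
  vintegrable nu (fun x => a * f x + g x)%R.
Proof.
move=> If Ig; split.
- have [mf _ _] := If; have [mg _ _] := Ig.
  by apply: measurable_funD => //; exact: measurable_funM.
- move=> z; have := cintegrableD a (vintegrable_cintegrable z If)
    (vintegrable_cintegrable z Ig).
  by case/integrableP.
- by move=> A mA; exists (a *: vintegral nu A f + vintegral nu A g)%R;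
    exact: vintegralD_subproof.
Qed.

Lemma vintegralD a f g A : vintegrable nu f -> vintegrable nu g ->
  measurable A -> vintegral nu A (fun x => a * f x + g x)%R =
    (a *: vintegral nu A f + vintegral nu A g)%R.
Proof. by move=> If Ig mA; apply/is_vintegral_unique/vintegralD_subproof. Qed.

Lemma L1_norm_ub f z : (`|z| <= 1)%R ->
  \int[charge_total_variation (S z)]_x `|f x|%:E <= L1_norm nu f.
Proof. by move=> z1; apply: ereal_sup_ubound; exists z. Qed.

Lemma L1_norm_le f c : (forall z, (`|z| <= 1)%R ->
  \int[charge_total_variation (S z)]_x `|f x|%:E <= c) -> L1_norm nu f <= c.
Proof. by move=> h; apply: ge_ereal_sup => _ [z z1 <-]; exact: h. Qed.

Lemma L1_norm_ge0 f : 0 <= L1_norm nu f.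
Proof.
apply: le_trans (@L1_norm_ub f 0%R _); first exact: integral_ge0.
by rewrite normr0.
Qed.

Lemma L1_norm_mono f g : measurable_fun setT f -> measurable_fun setT g ->
  (forall x, `|f x| <= `|g x|)%R -> L1_norm nu f <= L1_norm nu g.
Proof.
move=> mf mg fg; apply: L1_norm_le => z z1; apply: le_trans (L1_norm_ub g z1).
apply: ge0_le_integral => //; [exact: measurable_EFin_norm..|].
by move=> x _; rewrite lee_fin.
Qed.

Lemma L1_normD a f g : measurable_fun setT f -> measurable_fun setT g ->
  L1_norm nu (fun x => a * f x + g x)%R <=
  `|a|%:E * L1_norm nu f + L1_norm nu g.
Proof.
move=> mf mg; apply: L1_norm_le => z z1.
apply: (@le_trans _ _ (`|a|%:E * \int[charge_total_variation (S z)]_x `|f x|%:E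
    + \int[charge_total_variation (S z)]_x `|g x|%:E)); last first.
  by apply: leeD; [apply: lee_wpmul2l => //|]; exact: L1_norm_ub.
rewrite -ge0_integralZl_EFin//; last exact: measurable_EFin_norm.
rewrite -ge0_integralD//.
- apply: ge0_le_integral => //.
  + apply: measurable_EFin_norm; apply: measurable_funD => //.
    exact: measurable_funM.
  + apply: emeasurable_funD; last exact: measurable_EFin_norm.
    by apply: emeasurable_funM => //; exact: measurable_EFin_norm.
  + by move=> x _; rewrite -EFinM -EFinD lee_fin -normrM ler_normD.
- by apply: emeasurable_funM => //; exact: measurable_EFin_norm.
- exact: measurable_EFin_norm.
Qed.

Lemma L1_norm0 : L1_norm nu (fun=> 0%R) = 0.
Proof.
apply/eqP; rewrite eq_le L1_norm_ge0 andbT; apply: L1_norm_le => z _.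
by rewrite integral0_eq// => x _; rewrite normr0.
Qed.

Lemma L1_normZ_le a f : measurable_fun setT f ->
  L1_norm nu (fun x => a * f x)%R <= `|a|%:E * L1_norm nu f.
Proof.
move=> mf; have := L1_normD a mf (measurable_cst (0%R : R)).
rewrite [L1_norm nu (cst _)]L1_norm0 adde0; congr (L1_norm nu _ <= _).
by apply/funext => x; rewrite addr0.
Qed.

Lemma is_vintegral_indic f A B : vintegrable nu f -> measurable A ->
  measurable B -> is_vintegral nu A (fun x => f x * \1_B x)%R
    (vintegral nu (A `&` B) f).
Proof.
move=> If mA mB z; rewrite charge_integral_indic// vintegralP//.
exact: measurableI.
Qed.

Lemma le_norm_indic f B x : (`|f x * \1_B x| <= `|f x|)%R.
Proof. by rewrite normrM ler_piMr// indicE; case: (_ \in _); rewrite ?normr1 ?normr0. Qed.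

Lemma measurable_fun_indic f B : measurable_fun setT f -> measurable B ->
  measurable_fun setT (fun x => f x * \1_B x)%R.
Proof. by move=> mf mB; apply: measurable_funM. Qed.

Lemma vintegrable_indic f B : vintegrable nu f -> measurable B ->
  vintegrable nu (fun x => f x * \1_B x)%R.
Proof.
move=> If mB; have [mf foo _] := If; split; first exact: measurable_fun_indic.
- move=> z; apply: le_lt_trans (foo z); apply: ge0_le_integral => //.
  + exact/measurable_EFin_norm/measurable_fun_indic.
  + exact: measurable_EFin_norm.
  + by move=> x _; rewrite lee_fin le_norm_indic.
- by move=> A mA; exists (vintegral nu (A `&` B) f); exact: is_vintegral_indic.
Qed.

Lemma vintegral_indic f A B : vintegrable nu f -> measurable A -> measurable B ->
  vintegral nu A (fun x => f x * \1_B x)%R = vintegral nu (A `&` B) f.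
Proof. by move=> If mA mB; apply/is_vintegral_unique/is_vintegral_indic. Qed.

Lemma is_vintegral1 A : measurable A -> is_vintegral nu A (cst 1%R) (nu A).
Proof. by move=> mA z; rewrite charge_integral_cst1. Qed.

Lemma vintegrable1 : vintegrable nu (cst 1%R).
Proof.
split=> [//|z|A mA]; last by exists (nu A); exact: is_vintegral1.
have : cintegrable (S z) (cst 1%R).
  by apply: (@cintegrable_bounded _ _ _ _ _ 1%R) => // x; rewrite normr1.
by case/integrableP.
Qed.

Lemma vintegral1 A : measurable A -> vintegral nu A (cst 1%R) = nu A.
Proof. by move=> mA; exact/is_vintegral_unique/is_vintegral1. Qed.

Lemma vintegrable0 : vintegrable nu (fun=> 0%R).
Proof.
have := vintegrableD (-1)%R vintegrable1 vintegrable1.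
by congr (vintegrable nu); apply/funext => x; rewrite mulN1r addNr.
Qed.

Lemma vintegralZ a f A : vintegrable nu f -> measurable A ->
  vintegral nu A (fun x => a * f x)%R = (a *: vintegral nu A f)%R.
Proof.
move=> If mA; apply: is_vintegral_unique => z.
have := vintegralD_subproof a If vintegrable0 mA z.
have -> : vintegral nu A (fun=> 0%R) = 0%R.
  have := vintegralD (-1)%R vintegrable0 vintegrable0 mA.
  rewrite scaleN1r addNr => <-; congr (vintegral nu A).
  by apply/funext => x; rewrite mulr0 addr0.
by rewrite addr0 => ->; congr charge_integral; apply/funext => x; rewrite addr0.
Qed.

Lemma vintegrableZ a f : vintegrable nu f -> vintegrable nu (fun x => a * f x)%R.
Proof.
move=> If; have := vintegrableD a If vintegrable0.
by congr (vintegrable nu); apply/funext => x; rewrite addr0.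
Qed.

Lemma integral_variation_attained f z : vintegrable nu f ->
  exists2 B, measurable B &
    \int[charge_total_variation (S z)]_x `|f x|%:E =
    (z (vintegral nu B f - vintegral nu (~` B) f)%R)%:E.
Proof.
move=> If; have [B mB ->] := integral_TV_attained (vintegrable_cintegrable z If).
exists B => //; rewrite dual_subr EFinB !vintegralP//; exact: measurableC.
Qed.

(* Uniform boundedness principle for the functionals [z |-> z (int_A f dnu)]. *)
Lemma L1_norm_lty f : vintegrable nu f -> L1_norm nu f < +oo.
Proof.
move=> If.
pose ev (v : Z) : dual Z -> R^o := fun z => z v.
have [] := @Banach_Steinhauss R (dual Z) R^o
  [set ev (vintegral nu A f) | A in measurable] _ _ 1%R.
- move=> _ [A mA <-]; split; last by move=> a u v; rewrite /ev dualD dualZ.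
  move=> r; exists (r * `|vintegral nu A f|)%R => z zr.
  by rewrite (le_trans (dual_ler_norm _ _))// ler_wpM2r.
- move=> z; have /integrableP[_ foo] := vintegrable_cintegrable z If.
  exists (fine (\int[charge_total_variation (S z)]_x `|f x|%:E)) => _ [A mA <-].
  rewrite -lee_fin fineK; last first.
    by rewrite ge0_fin_numE ?integral_ge0.
  have := le_abse_charge_integral mA (vintegrable_cintegrable z If).
  by rewrite -vintegralP.
move=> M hM; apply: (@le_lt_trans _ _ (M + M)%:E); last exact: ltry.
apply: L1_norm_le => z z1; have [B mB ->] := integral_variation_attained z If.
rewrite lee_fin dual_subr (le_trans (ler_norm _))// (le_trans (ler_normB _ _))//.
by rewrite lerD//; [apply: (hM (ev (vintegral nu B f)))|
  apply: (hM (ev (vintegral nu (~` B) f)))] => //; [exists B|exists (~` B) => //; exact: measurableC].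
Qed.

Lemma le_vintegral f A : vintegrable nu f -> measurable A ->
  `|vintegral nu A f|%:E <= L1_norm nu f.
Proof.
move=> If mA; have := L1_norm_lty If; have := L1_norm_ge0 f.
case E : (L1_norm nu f) => [r| |]// _ _.
rewrite lee_fin; apply: dual_norm_point => z z1.
rewrite -lee_fin -E vintegralP// (le_trans (lee_abs _))//.
apply: le_trans (L1_norm_ub f z1).
exact/le_abse_charge_integral/vintegrable_cintegrable.
Qed.

End vector_measure_theory.

(** * Strong additivity: uniform smallness of a vector measure on tails *)

Section strong_additivity.
Context d (T : measurableType d) (R : realType) (Z : normedModType R).
Variable nu : vector_measure T Z.
Implicit Types (F : (set T)^nat) (A B C : set T).

Lemma vmeasureU A B : measurable A -> measurable B -> A `&` B = set0 ->
  nu (A `|` B) = nu A + nu B.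
Proof.
move=> mA mB AB; apply: dual_separates => z; rewrite dual_addr; apply: EFin_inj.
exact: (chargeU (scalarization nu z)).
Qed.

Lemma vmeasureD A B : measurable A -> measurable B ->
  nu A = nu (A `\` B) + nu (A `&` B).
Proof.
move=> mA mB; rewrite -vmeasureU ?setDE -?setIUr.
- by rewrite setUC setUv setIT.
- by apply: measurableI => //; exact: measurableC.
- exact: measurableI.
- by rewrite setIACA setICl setI0.
Qed.

Lemma measurable_tail F n : (forall i, measurable (F i)) ->
  measurable (\bigcup_(i >= n) F i).
Proof. by move=> mF; apply: bigcup_measurable. Qed.

Lemma bigcup_tailS F n :
  \bigcup_(i >= n) F i = F n `|` \bigcup_(i >= n.+1) F i.
Proof.
apply/seteqP; split=> [x [i /= ni Fx]|x [Fx|[i /= ni Fx]]]; last first.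
- by exists i => //=; exact: ltnW.
- by exists n => /=.
- move: ni; rewrite leq_eqVlt => /predU1P[->|ni]; [by left|right].
  by exists i.
Qed.

Lemma vmeasure_tail F n : (forall i, measurable (F i)) ->
  trivIset [set: nat] F ->
  nu (\bigcup_i F i) = \sum_(0 <= i < n) nu (F i) + nu (\bigcup_(i >= n) F i).
Proof.
move=> mF tF; elim: n => [|n ->].
  by rewrite big_geq// add0r; congr (nu _); apply/seteqP; split=> x [i _ Fx]; exists i.
rewrite big_nat_recr//= -addrA; congr (_ + _).
rewrite bigcup_tailS vmeasureU//; first exact: measurable_tail.
apply/seteqP; split => // x [Fn [i /= ni Fi]].
have /= e : n = i by apply: tF => //; exists x.
by move: ni; rewrite -e ltnn.
Qed.

Lemma cvg_vmeasure_tail F : (forall i, measurable (F i)) ->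
  trivIset [set: nat] F ->
  (fun n => nu (\bigcup_(i >= n) F i)) @ \oo --> (0 : Z).
Proof.
move=> mF tF; rewrite -(subrr (nu (\bigcup_i F i))).
rewrite (_ : (fun n => _) =
    (fun n => nu (\bigcup_i F i) - \sum_(0 <= i < n) nu (F i))); last first.
  by apply/funext => n; rewrite (vmeasure_tail n mF tF) addrAC subrr add0r.
by apply: cvgB; [exact: cvg_cst|exact: vmeasure_sigma_additive].
Qed.

Lemma trivIset_setIl F C : trivIset [set: nat] F ->
  trivIset [set: nat] (fun i => C `&` F i).
Proof. by move=> tF i j _ _ [x [[_ Fi] [_ Fj]]]; apply: tF => //; exists x. Qed.

(* Otherwise one extracts from the tails disjoint sets [C (k j) `\` tail] on
   which [nu] is bounded away from [0]. *)
Lemma vmeasure_tail_small F e : (forall i, measurable (F i)) ->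
  trivIset [set: nat] F -> 0 < e ->
  exists n, forall C, measurable C -> C `<=` \bigcup_(i >= n) F i -> `|nu C| <= e.
Proof.
move=> mF tF e0; apply: contrapT => /forallNP h.
pose B n := \bigcup_(i >= n) F i.
have mB n : measurable (B n) by exact: measurable_tail.
have Bnd n k : (n <= k)%N -> B k `<=` B n.
  by move=> nk x [i /= ki Fx]; exists i => //=; exact: leq_trans ki.
have /choice[C hC] : forall n, exists C, [/\ measurable C, C `<=` B n & e < `|nu C|].
  move=> n; move: (h n) => /existsNP[C /not_implyP[mC /not_implyP[CB /negP]]].
  by rewrite -ltNge => Ce; exists C.
(* For the fixed set [C n], the measure of its part inside the tail [B k] tends to [0] with [k];
   cutting off a late tail leaves more than [e / 2]. *)
have /choice[k hk] : forall n, exists k, (n < k)%N /\ e / 2 < `|nu (C n `\` B k)|.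
  move=> n; have [mC _ Ce] := hC n.
  have /cvgrPdist_le/(_ (e / 2)) := @cvg_vmeasure_tail (fun i => C n `&` F i)
    (fun i => measurableI _ _ mC (mF i)) (trivIset_setIl tF).
  rewrite divr_gt0// => /(_ erefl)[N _ hN]; exists (maxn n.+1 N).
  split; first exact: leq_maxl.
  have /= := hN (maxn n.+1 N) (leq_maxr _ _).
  rewrite sub0r normrN -setI_bigcupr => hs.
  move: Ce; rewrite (vmeasureD mC (mB (maxn n.+1 N))) => Ce.
  have := lt_le_trans Ce (ler_normD _ _); rewrite -/(B _) in hs; lra.
have [r rS] : exists r : nat -> nat, forall j, r j.+1 = k (r j).
  by exists (fun j => iter j k 0%N).
pose D j := C (r j) `\` B (k (r j)).
have mD j : measurable (D j) by have [mC _ _] := hC (r j); exact: measurableD.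
have rnd : {homo r : i j / (i <= j)%N >-> (i <= j)%N}.
  apply: homo_leq => [//|x y z|n]; first exact: leq_trans.
  by rewrite rS; have [/ltnW] := hk (r n).
have DB i j x : (i < j)%N -> D i x -> D j x -> False.
  move=> ij [_ nB] [Cx _]; apply: nB; have [_ CB _] := hC (r j).
  by apply: (Bnd _ (r j)); [rewrite -rS; exact: rnd|exact: CB].
have tD : trivIset [set: nat] D.
  move=> i j _ _ [x [Di Dj]]; apply/eqP; rewrite eqn_leq.
  by apply/andP; split; rewrite leqNgt; apply/negP => lt; [exact: (DB j i x lt Dj Di)|exact: (DB i j x lt Di Dj)].
(* Countable additivity on the disjoint [D j] forces [nu (D j)] to tend to [0], while each has norm
   above [e / 2]. *)
have cD : cvgn (series (nu \o D)).
  by apply/cvg_ex; exists (nu (\bigcup_j D j)); exact: vmeasure_sigma_additive.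
have /cvgrPdist_le/(_ (e / 2)) := cvg_series_cvg_0 cD.
rewrite divr_gt0// => /(_ erefl)[N _ /(_ N (leqnn _))].
rewrite /= sub0r normrN leNgt => /negP; apply.
by have [] := hk (r N).
Qed.

(** The variation of [z o nu] on [B] is [z] applied to a difference of two values of [nu] on subsets
    of [B]; each costs [c]. *)
Lemma L1_norm_indic_le B c : measurable B ->
  (forall C, measurable C -> C `<=` B -> `|nu C| <= c) ->
  (L1_norm nu (fun x => cst 1%R x * \1_B x)%R <= (c + c)%:E)%E.
Proof.
move=> mB Bc; apply: L1_norm_le => z z1.
have [D mD ->] := integral_variation_attained z (vintegrable_indic (vintegrable1 nu) mB).
have mDC := measurableC mD.
have int1 A : measurable A ->
    vintegral nu A (fun x => cst 1 x * \1_B x) = nu (A `&` B).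
  move=> mA; rewrite vintegral_indic//; last exact: vintegrable1.
  by rewrite vintegral1//; exact: measurableI.
rewrite !int1//.
rewrite lee_fin (le_trans (dual_le _ _))//.
rewrite (le_trans (ler_piMl (normr_ge0 _) z1))// (le_trans (ler_normB _ _))//.
by rewrite lerD// Bc//; [exact: measurableI|exact: measurableI].
Qed.

End strong_additivity.

(** * The factorization *)

Section unit_ball_image.
Context d (T : measurableType d) (R : realType) (X : completeNormedModType R).
Variable m : vector_measure T X.
Implicit Types (f : T -> R) (A B : set T) (g h : dual X).

Local Notation K := (integration_operator m @` L1_ball m).

Lemma integration_ball0 : K 0.
Proof.
exists (fun=> 0).
  split; first exact: vintegrable0.
  by rewrite L1_norm0.
have := vintegralZ 0 (vintegrable0 m) (@measurableT _ T).
by rewrite scale0r => <-; congr vintegral; apply/funext => x; rewrite mulr0.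
Qed.

Lemma integration_ball_norm k : K k -> `|k| <= 1.
Proof.
move=> [f [If f1] <-]; rewrite -lee_fin; apply: le_trans f1.
exact: le_vintegral.
Qed.

Lemma integration_ball_convex k l t : K k -> K l -> 0 <= t <= 1 ->
  K (k + t *: (l - k)).
Proof.
move=> [f [If f1] <-] [h [Ih h1] <-] /andP[t0 t1].
have I1 := vintegrableZ (1 - t) If.
exists (fun x => t * h x + (1 - t) * f x).
  split; first exact: vintegrableD.
  have [mf _ _] := If; have [mh _ _] := Ih; have [mf1 _ _] := I1.
  apply: le_trans (L1_normD _ _ mh mf1) _.
  have ft := L1_normZ_le m (1 - t) mf.
  have t1' : 0 <= 1 - t by rewrite subr_ge0.
  rewrite ger0_norm// in ft; rewrite ger0_norm//.
  apply: (@le_trans _ _ (t%:E * 1 + (1 - t)%:E * 1)%E).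
    apply: leeD; first by apply: lee_wpmul2l.
    by apply: le_trans ft _; apply: lee_wpmul2l.
  by rewrite !mule1 -EFinD addrC subrK.
rewrite /integration_operator vintegralD// vintegralZ//.
by rewrite scalerBr scalerBl scale1r addrC addrAC addrA.
Qed.

Lemma integration_ballN k : K k -> K (- k).
Proof.
move=> [f [If f1] <-].
have IN := vintegrableZ (-1) If; have [mf _ _] := If; have [mN _ _] := IN.
exists (fun x => -1 * f x).
  split=> //; apply: le_trans f1; apply: L1_norm_mono => // x.
  by rewrite mulN1r normrN.
by rewrite /integration_operator vintegralZ// scaleN1r.
Qed.

Definition integration_support g : R := sup [set `|g k| | k in K].

Let has_sup_support g : has_sup [set `|g k| | k in K].
Proof.
split; first by exists `|g 0|, 0 => //; exact: integration_ball0.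
exists `|g| => _ [k Kk <-]; apply: dual_norm_ub; exact: integration_ball_norm.
Qed.

Lemma integration_support_ub g k : K k -> `|g k| <= integration_support g.
Proof. by move=> Kk; apply: sup_upper_bound => //; exists k. Qed.

Lemma integration_support_le g c : (forall k, K k -> `|g k| <= c) ->
  integration_support g <= c.
Proof.
move=> h; apply: ge_sup; first by case: (has_sup_support g).
by move=> _ [k Kk <-]; exact: h.
Qed.

Let support_ge0 g : 0 <= integration_support g.
Proof. exact: le_trans (normr_ge0 _) (integration_support_ub g integration_ball0). Qed.

Let supportD g h :
  integration_support (g + h) <= integration_support g + integration_support h.
Proof.
apply: integration_support_le => k Kk; rewrite dualD (le_trans (ler_normD _ _))//.
by rewrite lerD// integration_support_ub.
Qed.

Let supportZ a g : integration_support (a *: g) = `|a| * integration_support g.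
Proof.
have le b h : integration_support (b *: h) <= `|b| * integration_support h.
  apply: integration_support_le => k Kk; rewrite dualZ normrM ler_wpM2l//.
  exact: integration_support_ub.
apply/eqP; rewrite eq_le le/=.
have [->|a0] := eqVneq a 0; first by rewrite normr0 mul0r.
rewrite -ler_pdivlMl ?normr_gt0// -normfV.
by rewrite -{1}[g]scale1r -(mulVf a0) -scalerA le.
Qed.

Let support_le_norm g : integration_support g <= `|g|.
Proof.
by apply: integration_support_le => k Kk; apply/dual_norm_ub/integration_ball_norm.
Qed.

Definition integration_seminorm : dual_seminorm X :=
  DualSeminorm support_ge0 supportD supportZ support_le_norm.

(** Dividing by [c] puts [f] times the indicator of [A] into the unit ball, so the scaled integral
    is a point of [K]. *)
Lemma le_vintegral_seminorm f A c g : vintegrable m f -> measurable A ->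
  0 <= c -> (L1_norm m f <= c%:E)%E ->
  `|g (vintegral m A f)| <= c * integration_seminorm g.
Proof.
move=> If mA; rewrite le_eqVlt => /predU1P[<-|c0] fc.
  have : (`|vintegral m A f|%:E <= 0)%E by exact: le_trans (le_vintegral If mA) fc.
  by rewrite lee_fin normr_le0 => /eqP ->; rewrite linear0 normr0 mul0r.
rewrite -ler_pdivrMl// -[c^-1]gtr0_norm ?invr_gt0// -normrM -dual_scaler.
apply: integration_support_ub.
have I1 := vintegrable_indic If mA; have [mf _ _] := If; have [mf1 _ _] := I1.
exists (fun x => c^-1 * (f x * \1_A x)); last first.
  by rewrite /integration_operator vintegralZ// vintegral_indic// setTI.
split; first exact: vintegrableZ.
apply: le_trans (L1_normZ_le m _ mf1) _.
rewrite gtr0_norm ?invr_gt0//.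
apply: (@le_trans _ _ (c^-1%:E * c%:E)%E); last by rewrite -EFinM mulVf ?gt_eqF.
apply: lee_wpmul2l; first by rewrite lee_fin invr_ge0 ltW.
by apply: le_trans fc; apply: L1_norm_mono => // x; exact: le_norm_indic.
Qed.

Lemma integration_seminorm_repr : weakly_compact_integration m ->
  forall (psi : {linear dual X -> R^o}) c, 0 <= c ->
    (forall g, psi g <= c * integration_seminorm g) ->
    exists x, forall g, psi g = g x.
Proof.
move=> wc psi c c0 psic.
(* Scaling by [c + 1] instead of [c] covers [c = 0]. *)
have c1 : 0 < c + 1 by rewrite ltr_wpDl.
pose psi1 g : R^o := (c + 1)^-1 * psi g.
have lpsi1 : linear psi1.
  by move=> a u v; rewrite /psi1 linearP/= mulrDr/= /GRing.scale/= mulrCA.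
pose Psi : {linear dual X -> R^o} := HB.pack psi1
  (GRing.isLinear.Build R (dual X) R^o *:%R psi1 lpsi1).
have [|g t gt|x xP] := @weakly_compact_representation R X K Psi _
    integration_ball_norm integration_ball_convex _ wc.
- by exists 0; exact: integration_ball0.
- rewrite /Psi/= /psi1 ler_pdivrMl//.
  (* Symmetry of [K] turns the one-sided bound by [t] into one on absolute values. *)
  have st : integration_seminorm g <= t.
    apply: integration_support_le => k Kk; rewrite ler_norml gt// andbT lerNl.
    by rewrite -dual_oppr gt//; exact: integration_ballN.
  rewrite (le_trans (psic g))// (le_trans (ler_wpM2l c0 st))//.
  by rewrite ler_wpM2r ?lerDl// (le_trans _ st)// seminorm_ge0.
- exists ((c + 1) *: x) => g; rewrite dual_scaler -xP /Psi/= /psi1.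
  by rewrite mulrA mulfV ?mul1r// gt_eqF.
Qed.

End unit_ball_image.

Section factorization.
Context d (T : measurableType d) (R : realType) (X : completeNormedModType R).
Variable m : vector_measure T X.
Implicit Types (f : T -> R) (A B : set T) (g : dual X).

Local Notation Y := (interp_space (integration_seminorm m)).
Local Notation J := (@interp_val R X (integration_seminorm m)).
Local Notation pull :=
  (dual_pullback (@interp_val_continuous R X (integration_seminorm m))).
Implicit Types h : dual Y.

Definition lift_vintegral A f : Y := insubd (0 : Y) (vintegral m A f).

Lemma lift_vintegralP A f : vintegrable m f -> measurable A ->
  J (lift_vintegral A f) = vintegral m A f /\
  (`|lift_vintegral A f|%:E <= L1_norm m f)%E.
Proof.
move=> If mA; have := L1_norm_lty If; have := L1_norm_ge0 m f.
case E : (L1_norm m f) => [c| |]// c0 _; rewrite lee_fin in c0.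
have [y yE yc] := interp_val_lift c0
  (fun g => le_vintegral_seminorm g If mA c0 (eq_ind_r (fun x => x <= _)%E (lexx _) E)).
by rewrite /lift_vintegral -yE valKd lee_fin.
Qed.

Lemma lift_vintegralE A f : vintegrable m f -> measurable A ->
  J (lift_vintegral A f) = vintegral m A f.
Proof. by move=> If mA; have [] := lift_vintegralP If mA. Qed.

Lemma le_lift_vintegral A f : vintegrable m f -> measurable A ->
  (`|lift_vintegral A f|%:E <= L1_norm m f)%E.
Proof. by move=> If mA; have [] := lift_vintegralP If mA. Qed.

(** Off the sigma-algebra [m A] is arbitrary and may lie outside [Y], where [insubd] falls back on
    [0]. *)
Definition factor_fun A : Y := insubd (0 : Y) (m A).

Lemma factor_funE A : measurable A -> J (factor_fun A) = m A.
Proof.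
move=> mA; have := lift_vintegralE (vintegrable1 m) mA.
by rewrite /lift_vintegral vintegral1.
Qed.

Lemma factor_fun0 : factor_fun set0 = 0.
Proof. by rewrite /factor_fun vmeasure0 -(linear0 J) valKd. Qed.

Lemma le_factor_fun A : measurable A ->
  (`|factor_fun A|%:E <= L1_norm m (fun x => cst 1%R x * \1_A x)%R)%E.
Proof.
move=> mA; have := le_lift_vintegral (vintegrable_indic (vintegrable1 m) mA) measurableT.
by rewrite /lift_vintegral vintegral_indic ?vintegral1 ?setTI//; exact: vintegrable1.
Qed.

Lemma factor_fun_sigma_additive (F : (set T)^nat) :
  (forall n, measurable (F n)) -> trivIset [set: nat] F ->
  (fun n => \sum_(0 <= i < n) factor_fun (F i)) @ \oo
    --> factor_fun (\bigcup_n F n).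
Proof.
move=> mF tF; apply/cvgrPdist_le => e e0.
(* Half of [e], because [L1_norm_indic_le] doubles the bound. *)
have [|N hN] := @vmeasure_tail_small _ _ _ _ m F (e / 2) mF tF; first by rewrite divr_gt0.
exists N => // n /= Nn.
have mtl k : measurable (\bigcup_(i >= k) F i) by exact: measurable_tail.
have -> : factor_fun (\bigcup_n F n) - \sum_(0 <= i < n) factor_fun (F i) =
    factor_fun (\bigcup_(i >= n) F i).
  apply: interp_val_inj; rewrite linearB linear_sum.
  transitivity (m (\bigcup_n F n) - \sum_(0 <= i < n) m (F i)).
    congr (_ - _); first by apply: factor_funE; exact: bigcupT_measurable.
    by apply: eq_bigr => i _; exact: factor_funE.
  rewrite (vmeasure_tail m n mF tF) addrAC subrr add0r.
  exact/esym/factor_funE.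
rewrite -lee_fin (splitr e); apply: le_trans (le_factor_fun (mtl n)) _.
apply: L1_norm_indic_le => // C mC CF; apply: hN => //.
by move=> x /CF [i /= ni Fx]; exists i => //=; exact: leq_trans ni.
Qed.

Definition factor_measure : vector_measure T Y :=
  VectorMeasure factor_fun0 factor_fun_sigma_additive.

Local Notation mt := factor_measure.

Lemma pullE g (y : Y) : pull g y = g (J y).
Proof. by []. Qed.

Lemma scalarization_pull g A : measurable A ->
  scalarization m g A = scalarization mt (pull g) A.
Proof.
move=> mA; rewrite /scalarization pullE; congr (g _)%:E.
exact/esym/factor_funE.
Qed.

Lemma charge_integral_pull g A f : measurable A ->
  charge_integral (scalarization m g) A f =
  charge_integral (scalarization mt (pull g)) A f.
Proof. exact/charge_integral_congr/scalarization_pull. Qed.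

Lemma integral_variation_pull g (u : T -> \bar R) :
  (\int[charge_total_variation (scalarization m g)]_x u x =
   \int[charge_total_variation (scalarization mt (pull g))]_x u x)%E.
Proof. exact/integral_TV_congr/scalarization_pull. Qed.

(* Both sides are linear and bounded in [h], and agree for [h] in the dense
   subspace of the [pull g]. *)
Lemma lift_vintegral_spec f A D : vintegrable m f -> measurable A ->
  (forall h, \int[charge_total_variation (scalarization mt h)]_x `|f x|%:E <=
     (D * `|h|)%:E)%E ->
  forall h, (h (lift_vintegral A f))%:E = charge_integral (scalarization mt h) A f.
Proof.
move=> If mA fD.
have mf : measurable_fun setT f by case: If.
have cf h : cintegrable (scalarization mt h) f.
  by apply: cintegrableP => //; apply: le_lt_trans (fD h) _; rewrite ltry.
pose L h : R := h (lift_vintegral A f) - fine (charge_integral (scalarization mt h) A f).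
suff L0 h : L h = 0.
  move=> h; have /eqP := L0 h; rewrite subr_eq0 => /eqP ->.
  by rewrite fineK// charge_integral_fin_num.
move: h; apply: (@interp_dual_density _ _ _ L (`|lift_vintegral A f| + D)) => [h k|g].
  have -> : L h - L k = L (h - k).
    have add : charge_integral (scalarization mt h) A f =
       (charge_integral (scalarization mt (h - k)%R) A f +
        charge_integral (scalarization mt k) A f)%E.
      apply: charge_integral_add => // B mB.
      by rewrite /scalarization -EFinD -dualD subrK.
    rewrite /L add fineD ?charge_integral_fin_num// dualD dualN.
    by rewrite opprD opprB !addrA subrK addrAC.
  rewrite /L (le_trans (ler_normB _ _))// mulrDl lerD//.
    by rewrite mulrC dual_ler_norm.
  rewrite -lee_fin; apply: le_trans (fD _).
  apply: le_trans (le_abse_charge_integral mA (cf _)).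
  by rewrite -{2}(fineK (charge_integral_fin_num mA (cf (h - k)))).
rewrite /L pullE lift_vintegralE// -charge_integral_pull//.
by rewrite -vintegralP//= subrr.
Qed.

(** A crude bound, whose point is to be linear in [|h|]: it supplies the constant asked by
    [lift_vintegral_spec] for bounded functions. *)
Lemma variation_factor_fun h A : measurable A ->
  (charge_total_variation (scalarization mt h) A <=
   (2 * fine (L1_norm m (cst 1%R)) * `|h|)%:E)%E.
Proof.
move=> mA; rewrite TV_hahn// /scalarization -EFinB lee_fin.
set N := fine _.
have le B : measurable B -> `|h (factor_fun B)| <= N * `|h|.
  move=> mB; rewrite (le_trans (dual_ler_norm _ _))// mulrC ler_wpM2r//.
  rewrite -lee_fin fineK; last first.
    by rewrite ge0_fin_numE ?L1_norm_ge0// L1_norm_lty//; exact: vintegrable1.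
  apply: le_trans (le_factor_fun mB) _.
  apply: L1_norm_mono => //; first exact: measurable_fun_indic.
  by move=> x; exact: le_norm_indic.
have [mP mQ] := measurable_hahn (scalarization mt h).
rewrite (le_trans (ler_norm _))// (le_trans (ler_normB _ _))//.
rewrite -mulrA mulr_natl mulr2n lerD//; apply: le; exact: measurableI.
Qed.

(** Estimating the integrals over [B] and its complement separately would cost a factor two. They
    are combined into the single integral of [u], which is [f] on [B] and [- f] off it, so that
    [|u| = |f|] and the constant is one. *)
Lemma integral_bounded_variation_factor f C h : vintegrable m f ->
  (forall x, `|f x| <= C) ->
  (\int[charge_total_variation (scalarization mt h)]_x `|f x|%:E <=
   `|h|%:E * L1_norm m f)%E.
Proof.
move=> If fC; have mf : measurable_fun setT f by case: If.
have C0 : 0 <= C := le_trans (normr_ge0 _) (fC point).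
have spec := @lift_vintegral_spec f _ (C * (2 * fine (L1_norm m (cst 1%R)))) If.
have {}spec A : measurable A -> forall k : dual Y,
    (k (lift_vintegral A f))%:E = charge_integral (scalarization mt k) A f.
  move=> mA; apply: spec => // k.
  apply: (@le_trans _ _ (\int[charge_total_variation (scalarization mt k)]_x C%:E)%E).
    apply: ge0_le_integral => //; first exact: measurable_EFin_norm.
    by move=> x _; rewrite lee_fin.
  rewrite integral_cst// -mulrA EFinM lee_wpmul2l//.
  exact: variation_factor_fun.
have [B mB ->] := integral_TV_attained (cintegrable_bounded (scalarization mt h) mf fC).
have mCB := measurableC mB.
rewrite -!spec// -EFinB -dual_subr.
pose u x := -1 * (f x * \1_(~` B) x) + f x * \1_B x.
have I1 := vintegrable_indic If mB; have I2 := vintegrable_indic If mCB.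
have Iu : vintegrable m u by exact: vintegrableD.
have -> : lift_vintegral B f - lift_vintegral (~` B) f = lift_vintegral setT u.
  apply: interp_val_inj; rewrite linearB.
  transitivity (vintegral m B f - vintegral m (~` B) f).
    by congr (_ - _); exact: lift_vintegralE.
  apply: etrans (esym (lift_vintegralE Iu measurableT)).
  by rewrite vintegralD// !vintegral_indic// !setTI scaleN1r addrC.
apply: (@le_trans _ _ (`|h|%:E * `|lift_vintegral setT u|%:E)%E).
  by rewrite -EFinM lee_fin dual_le.
apply: lee_wpmul2l => //; apply: le_trans (le_lift_vintegral Iu measurableT) _.
apply: L1_norm_mono => //; first by case: Iu.
move=> x; rewrite /u !indicE in_setC; case: (x \in B) => /=.
  by rewrite mulr0 mulr0 add0r mulr1.
by rewrite mulr0 addr0 mulr1 mulN1r normrN.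
Qed.

(** Truncation to the sets where [|f| <= k], then monotone convergence; the bound for the
    truncations does not involve [k]. *)
Lemma integral_variation_factor f h : vintegrable m f ->
  (\int[charge_total_variation (scalarization mt h)]_x `|f x|%:E <=
   `|h|%:E * L1_norm m f)%E.
Proof.
move=> If; have mf : measurable_fun setT f by case: If.
pose E k := [set x | `|f x| <= k%:R].
have mE k : measurable (E k).
  rewrite (_ : E k = setT `&` (Num.norm \o f) @^-1` `]-oo, k%:R]%classic).
    by apply: (measurableT_comp (@normr_measurable _ setT) mf).
  by rewrite setTI; apply/seteqP; split=> x; rewrite /E/= in_itv.
have Ek k : (\int[charge_total_variation (scalarization mt h)]_(x in E k) `|f x|%:E <=
   `|h|%:E * L1_norm m f)%E.
  have Ik := vintegrable_indic If (mE k).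
  apply: (@le_trans _ _ (`|h|%:E * L1_norm m (fun x => f x * \1_(E k) x)%R)%E).
    rewrite integral_mkcond.
    have := @integral_bounded_variation_factor _ k%:R h Ik _.
    rewrite (_ : _ \_ _ = (fun x => `|f x * \1_(E k) x|%:E)); last first.
      apply/funext => x; rewrite /patch indicE; case: ifPn => _ /=.
        by rewrite mulr1.
      by rewrite mulr0 normr0.
    apply=> x; rewrite indicE; case: (boolP (x \in E k)) => [/[!inE]|_] /=.
      by rewrite mulr1.
    by rewrite mulr0 normr0.
  apply: lee_wpmul2l => //; apply: L1_norm_mono => //.
    exact: measurable_fun_indic.
  by move=> x; exact: le_norm_indic.
have ET : \bigcup_k E k = setT.
  apply/seteqP; split=> // x _; exists (Num.truncn `|f x|).+1 => //.
  by rewrite /E/= ltW// Num.Theory.truncnS_gt.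
have : (\int[charge_total_variation (scalarization mt h)]_(x in E k) `|f x|%:E)%E
    @[k --> \oo] -->
    (\int[charge_total_variation (scalarization mt h)]_(x in \bigcup_k E k) `|f x|%:E)%E.
  apply: ge0_nondecreasing_set_cvg_integral => //.
    by move=> i j ij; apply/subsetPset => x /le_trans; apply; rewrite ler_nat.
  by move=> i; exact: measurable_EFin_norm.
rewrite ET => hc.
apply: (closed_cvg _ (@closed_ereal_ge_ereal _ _) _ _ hc).
exact: nearW.
Qed.

(** Forwards, [integral_variation_factor] is the bound linear in [|h|] that density requires.
    Backwards, [J] of the integral in [Y] works, since testing it with [g] is testing in [Y] with
    [pull g]. *)
Lemma vintegrable_factor f : vintegrable m f <-> vintegrable mt f.
Proof.
split=> If; have mf : measurable_fun setT f by case: If.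
  have Nfin : L1_norm m f \is a fin_num.
    by rewrite ge0_fin_numE ?L1_norm_ge0// L1_norm_lty.
  have fN h : (\int[charge_total_variation (scalarization mt h)]_x `|f x|%:E <=
      (fine (L1_norm m f) * `|h|)%:E)%E.
    by rewrite EFinM fineK// muleC integral_variation_factor.
  split=> // [h|A mA]; first by apply: le_lt_trans (fN h) _; rewrite ltry.
  by exists (lift_vintegral A f) => h; exact: (lift_vintegral_spec If mA fN).
have [_ foo fA] := If.
split=> // [g|A mA]; first by rewrite integral_variation_pull.
have [y yP] := fA A mA; exists (J y) => g.
by rewrite charge_integral_pull// -yP.
Qed.

Lemma L1_norm_factor f : vintegrable m f -> L1_norm m f = L1_norm mt f.
Proof.
move=> If; apply/eqP; rewrite eq_le; apply/andP; split; apply: L1_norm_le => h h1.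
  rewrite integral_variation_pull; apply: L1_norm_ub.
  apply: dual_norm_le => y y1; rewrite pullE (le_trans (dual_ler_norm _ _))//.
  by rewrite mulr_ile1// (le_trans (interp_val_norm _)).
apply: le_trans (integral_variation_factor h If) _.
by rewrite -[leRHS]mul1e lee_wpmul2r ?L1_norm_ge0// lee_fin.
Qed.

(** Reduces null sets to norms of indicators, so that equality of the norms also gives the same
    identification of functions. *)
Lemma semivariationE (Z : normedModType R) (nu : vector_measure T Z) A :
  measurable A -> semivariation nu A = L1_norm nu (fun x => cst 1%R x * \1_A x)%R.
Proof.
move=> mA; rewrite /semivariation /L1_norm; congr ereal_sup.
apply: eq_imagel => z _.
rewrite -[RHS]/(_ _) (_ : (fun x => _) = (fun x => (\1_A x)%:E)); last first.
  by apply/funext => x; rewrite mul1r ger0_norm.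
by rewrite integral_indic// setIT.
Qed.

Lemma factor_isometric : L1_isometric_eq m mt.
Proof.
split; [exact: vintegrable_factor|move=> f g _ _|exact: L1_norm_factor].
suff h A : measurable A -> semivariation m A = semivariation mt A.
  by split=> -[mA A0]; split=> //; [rewrite -h|rewrite h].
move=> mA; rewrite !semivariationE// L1_norm_factor//.
by apply: vintegrable_indic => //; exact: vintegrable1.
Qed.

End factorization.

Theorem corollary4p7 (d : measure_display) (T : measurableType d) (R : realType)
    (X : completeNormedModType R) (m : vector_measure T X)
    (m_neq0 : exists A : set T, measurable A /\ m A <> 0)
    (wc : weakly_compact_integration m) :
  exists (Y : completeNormedModType R) (mt : vector_measure T Y)
         (J : {linear Y -> X}),
    [/\ reflexive_space Y,
        continuous J,
        injective J,
        forall A : set T, measurable A -> m A = J (mt A) &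
        L1_isometric_eq m mt].
Proof.
exists (interp_space (integration_seminorm m)), (factor_measure m),
  (@interp_val R X (integration_seminorm m)); split.
- exact/interp_reflexive/integration_seminorm_repr.
- exact: interp_val_continuous.
- exact: interp_val_inj.
- by move=> A mA; exact/esym/factor_funE.
- exact: factor_isometric.
Qed.
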